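(* Let $N$ be a positive integer and let $Y=(1,2,\dots,N)$ (the step initial condition). Let $x\in\mathbb{Z}$ and $t\ge 0$. Consider the TASEP with second class particles started from the state $(Y,21\cdots1)$, and let $E_t$ be the event that at time $t$ the species word is $21\cdots1$ and the leftmost particle is at $x$, i.e. $E_t=\{(X,21\cdots1;t)\colon x_1=x\}$. Let $C$ be a counterclockwise circle centered at the origin with radius less than $1$. Then $$\mathbb{P}_{(Y,21\cdots1)}(E_t)=(-1)^{N(N-1)/2}\det\left[\frac{1}{2\pi \sqrt{-1}}\oint_C\xi^{\,i+j+x-N-1}(\xi-1)^{-(N-1)}e^{(1/\xi-1)t}\,d\xi\right]_{i,j=0}^{N-1}.$$
   Context: The TASEP with second class particles (with $N$ particles) is the continuous-time Markov process defined as follows. Each site of $\mathbb{Z}$ is occupied by at most one particle and each particle belongs to species $1$ or species $2$. Particles of species $1$ are called second class particles and particles of species $2$ are called first class particles. Each particle, located at $z$ say, tries to jump to $z+1$ after an exponentially distributed waiting time of rate $1$ (independently for all particles). If $z+1$ is empty, the particle jumps to $z+1$. If $z+1$ is occupied by a particle of the same species, the jump is forbidden and the waiting time is reset. If the particle at $z$ is of species $2$ and $z+1$ is occupied by a particle of species $1$, the two particles interchange positions. If the particle at $z$ is of species $1$ and $z+1$ is occupied by a particle of species $2$, the jump is forbidden and the waiting time is reset. A state is a pair $(X,\pi)$ with $X=(x_1,\dots,x_N)\in\mathbb{Z}^N$, $x_1<\cdots<x_N$, and $\pi=\pi_1\cdots\pi_N$ a word in $\{1,2\}$; it means that the $i$-th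 particle from the left is at $x_i$ and is of species $\pi_i$. The notation $(X,\pi;t)$ means the state at time $t$ is $(X,\pi)$. $\mathbb{P}_{(Y,\nu)}$ is the probability measure of the process with initial state $(Y,\nu)$. *)

(* Defs.v *)
From HB Require Import structures.
From mathcomp Require Import all_boot all_order all_fingroup all_algebra.
From mathcomp Require Import all_classical all_reals all_analysis.
From mathcomp Require Import complex.

Set Implicit Arguments.
Unset Strict Implicit.
Unset Printing Implicit Defensive.

Import Order.TTheory GRing.Theory Num.Theory.
Import numFieldNormedType.Exports.

Local Open Scope classical_set_scope.
Local Open Scope ring_scope.

(** * Time-homogeneous Markov processes in continuous time *)

Section MarkovProcess.
Context {R : realType} {S : choiceType}.

(* [p t s s'] is the probability to go from [s] to [s'] in time [t]; only the
   values at [0 <= t] are relevant. *)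
Definition transition_function (p : R -> S -> S -> R) : Prop :=
  [/\ forall t s s', 0 <= t -> 0 <= p t s s',
      forall t s, 0 <= t -> \esum_(s' in [set: S]) (p t s s')%:E = 1%E,
      forall s s', p 0 s s' = (s == s')%:R &
      forall t u s s', 0 <= t -> 0 <= u ->
        (p (t + u) s s')%:E = \esum_(z in [set: S]) (p t s z * p u z s')%:E].

(* For [s != s'], [q s s'] is the rate of the transition from [s] to [s'], i.e.
   [p h s s' = (s == s')%:R + h * q s s' + o(h)] as [h] tends to 0 from the
   right. *)
Definition has_rates (p : R -> S -> S -> R) (q : S -> S -> R) : Prop :=
  forall s s', (p h s s' - (s == s')%:R) / h @[h --> 0^'+] --> q s s'.

(* The [past] in the Markov property is an arbitrary finite list of pairs
   [(u, z)], read as "the state at time [u] is [z]". *)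
Definition markov_process {d} {W : measurableType d} (P : probability W R)
    (Z : R -> W -> S) (p : R -> S -> S -> R) (s0 : S) : Prop :=
  [/\ forall t s, 0 <= t -> measurable [set w | Z t w = s],
      P [set w | Z 0 w = s0] = 1%E &
      forall (past : seq (R * S)) (t h : R) (s s' : S),
        (forall uz, uz \in past -> 0 <= uz.1 <= t) -> 0 <= t -> 0 <= h ->
        P [set w | [/\ forall uz, uz \in past -> Z uz.1 w = uz.2,
                       Z t w = s & Z (t + h) w = s']] =
        (P [set w | (forall uz, uz \in past -> Z uz.1 w = uz.2) /\
                    Z t w = s] * (p h s s')%:E)%E].

Definition markov_process_with_rates {d} {W : measurableType d}
    (P : probability W R) (Z : R -> W -> S) (q : S -> S -> R) (s0 : S) : Prop :=
  exists p, [/\ transition_function p, has_rates p q & markov_process P Z p s0].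

End MarkovProcess.

(** * The TASEP with second class particles *)

Definition species := bool.
(* Species 1 is the second class, species 2 the first class. *)
Definition second_class : species := false.
Definition first_class : species := true.

Definition increasing N (X : {ffun 'I_N -> int}) : bool :=
  [forall i : 'I_N, forall j : 'I_N, (i < j)%N ==> (X i < X j)].

(* The state [(X, pi)]. Indices start at 0: [pos s i] and [word s i] are the
   position and the species of the [i.+1]-th particle from the left. *)
Record state N := State {
  config : {ffun 'I_N -> int} * {ffun 'I_N -> species};
  _ : increasing config.1 }.

HB.instance Definition _ N := [isSub for @config N].
HB.instance Definition _ N := [Countable of state N by <:].

Definition pos N (s : state N) : {ffun 'I_N -> int} := (config s).1.
Definition word N (s : state N) : {ffun 'I_N -> species} := (config s).2.

Definition step_right N (X : {ffun 'I_N -> int}) (i : 'I_N) : {ffun 'I_N -> int} :=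
  [ffun k => if k == i then X k + 1 else X k].

Definition swap_word N (w : {ffun 'I_N -> species}) (i j : 'I_N) :
  {ffun 'I_N -> species} := [ffun k => w (tperm i j k)].

(* The outcome of a jump attempt by the [i]-th particle: the target site is
   either empty or occupied by some [j]. *)
Definition attempt_config N (s : state N) (i : 'I_N) :=
  if [pick j | pos s j == pos s i + 1] is Some j then
    if (word s i == first_class) && (word s j == second_class)
    then (pos s, swap_word (word s) i j) else (pos s, word s)
  else (step_right (pos s) i, word s).

Lemma attempt_increasing N (s : state N) (i : 'I_N) :
  increasing (attempt_config s i).1.
Proof.
rewrite /attempt_config; have sP : increasing (pos s) := valP s.
case: pickP => [j _|free]; first by case: ifP.
apply/'forall_'forall_implyP => j k ltjk /=.
have := forallP (forallP sP j) k; rewrite ltjk /= => ltX.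
rewrite !ffunE; case: (eqVneq j i) ltX => [->|_] ltX.
  rewrite ifF; last by apply/eqP => ki; rewrite ki in ltX; rewrite ltxx in ltX.
  by rewrite lt_neqAle eq_sym free /= lezD1.
by case: ifP => _ //; rewrite (lt_trans ltX) // ltrDl.
Qed.

Definition attempt N (i : 'I_N) (s : state N) : state N :=
  State (attempt_increasing s i).

(* Each particle attempts a jump at rate 1, independently of the others: the
   rates of the [N] exponential clocks add up. A forbidden attempt leaves the
   state unchanged and contributes 0. The diagonal entry is minus the total
   rate of leaving [s]. *)
Definition tasep_rate (R : realType) N (s s' : state N) : R :=
  \sum_(i < N) ((attempt i s == s')%:R - (s == s')%:R).

Definition is_tasep (R : realType) d (W : measurableType d)
    (P : probability W R) N (Z : R -> W -> state N) (s0 : state N) : Prop :=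
  markov_process_with_rates P Z (@tasep_rate R N) s0.

Definition step_pos N : {ffun 'I_N -> int} := [ffun i : 'I_N => i.+1%:Z].

(* The word 21...1 *)
Definition word21 N : {ffun 'I_N -> species} :=
  [ffun i : 'I_N => if val i == 0%N then first_class else second_class].

Lemma step_pos_increasing N : increasing (step_pos N).
Proof.
by apply/'forall_'forall_implyP => i j ltij; rewrite !ffunE ltz_nat ltnS.
Qed.

Definition step_state N : state N :=
  @State N (step_pos N, word21 N) (step_pos_increasing N).

Definition E_event N (hN : (0 < N)%N) (x : int) : set (state N) :=
  [set s | word s = word21 N /\ pos s (Ordinal hN) = x].

(** * Contour integrals *)

Section Contour.
Context {R : realType}.
Local Open Scope complex_scope.

Definition cexp (z : R[i]) : R[i] :=
  (expR (complex.Re z))%:C * (cos (complex.Im z) +i* sin (complex.Im z)).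

Definition cintegral (a b : R) (f : R -> R[i]) : R[i] :=
  Rintegral lebesgue_measure `[a, b] (fun u => complex.Re (f u)) +i*
  Rintegral lebesgue_measure `[a, b] (fun u => complex.Im (f u)).

(* The integral of [f] along the circle of radius [r] centered at the origin,
   traversed once counterclockwise. *)
Definition circle_integral (r : R) (f : R[i] -> R[i]) : R[i] :=
  cintegral 0 (2 * pi) (fun u =>
    let z := r%:C * cexp (0 +i* u) in f z * ('i%C * z)).

End Contour.

(* Main.v *)
(** Adding up the transition probabilities into the event gives a function
    [u t s] of the initial state [s] that satisfies the backward equation
    [d/dt u = generator u]: the error of the expansion of [u (d + t) s] at
    small [d] is uniform in [t], so [u] is differentiable from both sides.

    A second solution is
    [det (Phi (N-1-max(k-1,0)) (y_k - x - a) t)]_{k,a}, extended by 0 to the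
    words other than 21...1, where [Phi p m t] is the contour integral of
    [xi^(-1-m) (1-xi)^(-p) exp((1/xi-1)t)]. Indeed [d/dt] acts on [Phi] as the
    unit forward difference in [m], and
    [Phi (p+1) m - Phi (p+1) (m-1) = Phi p m] turns collisions into
    determinants with two equal rows. At [t = 0] this same recursion reduces
    the determinant to smaller ones until it is 0 or 1.

    Both solutions agree by uniqueness in a class of functions that grow at
    most exponentially in the positions. For step initial data the determinant
    becomes the stated one by a unitriangular change of rows and a reversal
    of the rows, of sign [(-1)^(N(N-1)/2)]. *)

Require Import Defs.
From mathcomp Require Import all_boot all_order all_algebra.
From mathcomp Require Import all_classical all_reals all_analysis.
From mathcomp Require Import complex.
From mathcomp Require Import perm zify ring lra.

Import Order.TTheory GRing.Theory Num.Theory.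
Import numFieldNormedType.Exports.
Local Open Scope classical_set_scope.
Local Open Scope ring_scope.
Local Open Scope complex_scope.

Set Implicit Arguments.
Unset Strict Implicit.
Unset Printing Implicit Defensive.

(** * Determinants *)

Section BetheDeterminant.
Variable K : comNzRingType.
Implicit Types A F : nat -> int -> K.

(** Multiplying by the unitriangular [D] subtracts from each column its right neighbour. The last
    row becomes [(0, ..., 0, 1)], and expansion along it leaves the matrix of differences. *)
Lemma det_last_row1 n (B : 'M[K]_n.+1) :
    (forall b, B ord_max b = 1) ->
  \det B = \det (\matrix_(a < n, b < n)
    (B (widen_ord (leqnSn n) a) (widen_ord (leqnSn n) b) -
     B (widen_ord (leqnSn n) a) (lift ord0 b))).
Proof.
move=> B1.
pose D : 'M[K]_n.+1 :=
  \matrix_(k, b) ((k == b)%:R - (k == b.+1 :> nat)%:R).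
have detD : \det D = 1.
  rewrite det_trig; last first.
    apply/is_trig_mxP => i j ltij; rewrite mxE.
    rewrite -[i == j]/(i == j :> nat) ltn_eqF// ltn_eqF ?subrr//.
    by rewrite ltnW.
  by apply: big1 => i _; rewrite mxE eqxx ltn_eqF// subr0.
have DE a b : (B *m D) a b =
    B a b - (if (b < n)%N then B a (inord b.+1) else 0).
  rewrite mxE (eq_bigr (fun k => B a k * (k == b)%:R - B a k * (k == b.+1 :>
      nat)%:R)); last first.
    by move=> k _; rewrite mxE mulrBr.
  rewrite sumrB; congr (_ - _).
    rewrite (bigD1 b)//= eqxx mulr1 big1 ?addr0// => k /negPf ->.
    by rewrite mulr0.
  case: ifPn => [ltbn|].
    rewrite (bigD1 (inord b.+1))//= inordK// eqxx mulr1 big1 ?addr0// => k kb.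
    case: eqP => [e|]; last by rewrite mulr0.
    by case/eqP: kb; apply: val_inj; rewrite /= inordK.
  rewrite -leqNgt => lenb; rewrite big1// => k _.
  by rewrite ltn_eqF ?mulr0// (leq_trans (ltn_ord k)).
rewrite -[LHS]mulr1 -detD -det_mulmx (expand_det_row _ ord_max).
rewrite (bigD1 ord_max)//= big1 ?addr0; last first.
  move=> b; rewrite -val_eqE /= => nb; rewrite DE ifT ?B1 ?subrr ?mul0r//.
  by rewrite ltn_neqAle nb -ltnS ltn_ord.
rewrite DE ltnn subr0 B1 mul1r /cofactor addnn -signr_odd odd_double expr0 mul1r.
congr (\det _); apply/matrixP => a b; rewrite !mxE.
rewrite (_ : \sum_j _ = (B *m D) (lift ord_max a) (lift ord_max b)); last first.
  by rewrite mxE.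
have wE (c : 'I_n) : lift ord_max c = widen_ord (leqnSn n) c.
  by apply: val_inj; rewrite /= /bump leqNgt ltn_ord.
rewrite DE !wE /= (ltn_ord b : (b < n)%N); congr (_ - B _ _).
by apply: val_inj; rewrite /= inordK// ltnS; exact: ltn_ord b.
Qed.

(** Since [0.-1 = 0], rows 0 and 1 share the order [N.-1]; from row 1 on, the order drops by one per
    row. The first fact encodes overtaking, the second exclusion. *)
Definition bethe_mx F N (m : 'I_N -> int) : 'M[K]_N :=
  \matrix_(k, a) F (N.-1 - k.-1)%N (m k - a%:Z).

(** * Value of the determinant at time 0 *)

Section InitialValues.
Variable A : nat -> int -> K.
Hypothesis A0 : forall m : int, A 0%N m = (m == 0)%:R.
Hypothesis Aneg : forall p (m : int), m < 0 -> A p m = 0.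
Hypothesis Arec : forall p m, A p.+1 m - A p.+1 (m - 1) = A p m.

Let Adiff p m : A p.+1 m = A p m + A p.+1 (m - 1).
Proof. by rewrite -(Arec p m) subrK. Qed.

Let A_0 p : A p 0 = 1.
Proof. by elim: p => [|p IHp]; rewrite ?A0// Adiff IHp Aneg ?addr0. Qed.

Let A1_ge0 (m : int) : 0 <= m -> A 1%N m = 1.
Proof.
case: m => // n _; elim: n => [|n IHn]; first exact: A_0.
rewrite Adiff A0 (_ : n.+1%:Z - 1 = n%:Z) ?IHn ?add0r//; lia.
Qed.

(** The last row has order 1 and nonnegative arguments, so it is constant 1. Taking column
    differences lowers every order by one, which gives the same kind of matrix one size smaller. *)
Lemma det_initial1 n (m : 'I_n -> int) : (forall b : 'I_n, b%:Z <= m b) ->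
  \det (\matrix_(b < n, a < n) A (n - b)%N (m b - a%:Z)) = 1.
Proof.
elim: n m => [|n IHn] m mP; first by rewrite det_mx00.
rewrite det_last_row1; last first.
  move=> b; rewrite mxE subSnn A1_ge0// subr_ge0.
  by rewrite (le_trans _ (mP _))//= lez_nat -ltnS.
rewrite -[RHS](IHn (fun b => m (widen_ord (leqnSn n) b))); last first.
  by move=> b; exact: (mP (widen_ord _ _)).
congr (\det _); apply/matrixP => b a; rewrite !mxE /= subSn; last exact: ltnW.
rewrite -[RHS]Arec; congr (_ - A _ _); rewrite /bump /=; lia.
Qed.

(** The same reduction by column differences, down to size 2, where both rows have order 1 and
    consist of ones. *)
Lemma det_initial0 n (m : 'I_n.+2 -> int) :
  (forall b : 'I_n.+2, b.+1%:Z <= m b) -> \det (bethe_mx A m) = 0.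
Proof.
elim: n m => [|n IHn] m mP.
  apply: (determinant_alternate (i1 := ord0) (i2 := ord_max)) => // a.
  have aP := ltn_ord a.
  rewrite !mxE /= !A1_ge0//.
    by have := mP ord_max => /=; lia.
  by have := mP ord0 => /=; lia.
rewrite det_last_row1; last first.
  move=> b; rewrite mxE /= subSnn A1_ge0//.
  by have := mP ord_max; have := ltn_ord b => /=; lia.
rewrite -[RHS](IHn (fun b => m (widen_ord (leqnSn _) b))); last first.
  by move=> b; exact: (mP (widen_ord _ _)).
congr (\det _); apply/matrixP => b a; rewrite !mxE /= subSn; last first.
  by have := ltn_ord b; lia.
rewrite -[RHS]Arec; congr (_ - A _ _); rewrite /bump /=; lia.
Qed.

(** The sign of [m ord0] decides. If it is negative, row 0 vanishes. If it is positive,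
    [det_initial0] applies, or [A0] in size 1. If it is zero, row 0 is [(1, 0, ..., 0)] and its
    minor is the matrix of [det_initial1]. Monotonicity of [m] supplies the bounds through [mge]. *)
Lemma det_bethe_mx_initial N (m : 'I_N.+1 -> int) :
    {homo m : i j / (i < j)%N >-> i < j} ->
  \det (bethe_mx A m) = (m ord0 == 0)%:R.
Proof.
move=> m_incr.
have mge (b : 'I_N.+1) : m ord0 + b%:Z <= m b.
  case: b => b bN; elim: b bN => [|b IHb] bN.
    by rewrite addr0 (_ : Ordinal bN = ord0)//; exact: val_inj.
  have := IHb (ltnW bN); have := m_incr (Ordinal (ltnW bN)) (Ordinal bN) (ltnSn b).
  by move=> /=; lia.
have [m0|m0|m0] := ltgtP (m ord0) 0.
- rewrite (expand_det_row _ ord0) big1// => a _; rewrite mxE Aneg ?mul0r//; lia.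
- case: N m {m_incr} mge m0 => [|N] m mge m0.
    by rewrite det_mx11 mxE A0 subr0 gt_eqF.
  by apply: det_initial0 => b; have := mge b; lia.
- rewrite (expand_det_row _ ord0) (bigD1 ord0)//= big1 ?addr0; last first.
    move=> a a0; rewrite mxE Aneg ?mul0r// m0.
    have : (0 < a)%N by rewrite lt0n.
    by lia.
  rewrite mxE m0 subr0 A_0 mul1r /cofactor expr0 mul1r.
  rewrite -[RHS](@det_initial1 N (fun b => m (lift ord0 b) - 1)); last first.
    by move=> b; have := mge (lift ord0 b); rewrite m0 /= /bump /=; lia.
  congr (\det _); apply/matrixP => b a; rewrite !mxE /= /bump /=.
  congr (A _ _); lia.
Qed.

End InitialValues.

Lemma det_bethe_mx_kill F N (m : 'I_N -> int) (i j : 'I_N) :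
  i = 0%N :> nat -> j = 1%N :> nat -> m i = m j -> \det (bethe_mx F m) = 0.
Proof.
move=> i0 j1 mij; apply: (determinant_alternate (i1 := i) (i2 := j)).
  by rewrite -val_eqE /= i0 j1.
by move=> a; rewrite !mxE i0 j1 mij.
Qed.

(** For [0 < i] the order of row [i] exceeds that of row [i.+1] by one. By the recursion, raising
    the argument of row [i] adds to it exactly row [j], which does not change the determinant. *)
Lemma det_bethe_mx_block F N (m : 'I_N -> int) (i j : 'I_N) :
    (forall p m, F p.+1 m - F p.+1 (m - 1) = F p m) ->
    (0 < i)%N -> j = i.+1 :> nat -> m j = m i + 1 ->
  \det (bethe_mx F (fun k => m k + (k == i)%:R)) = \det (bethe_mx F m).
Proof.
move=> Frec i0 ji mij.
pose B : 'M[K]_N := \matrix_(k, a)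
  if k == i then bethe_mx F m j a else bethe_mx F m k a.
have jNi : j != i by rewrite -val_eqE /= ji gtn_eqF.
have B0 : \det B = 0.
  apply: (determinant_alternate (i1 := i) (i2 := j)); first by rewrite eq_sym.
  by move=> a; rewrite !mxE eqxx (negPf jNi).
have lin := @determinant_multilinear _ _
  (bethe_mx F (fun k => m k + (k == i)%:R)) (bethe_mx F m) B i 1 1.
rewrite lin ?B0 ?mul1r ?addr0//.
- rewrite !scale1r; apply/rowP => a; rewrite !mxE eqxx/=.
  have pE : (N.-1 - i.-1 = (N.-1 - j.-1).+1)%N by have := ltn_ord j; lia.
  rewrite pE mij -(Frec _ (m i + 1 - a%:Z)).
  by rewrite (_ : m i + 1 - a%:Z - 1 = m i - a%:Z) 1?[RHS]addrC ?subrK//; lia.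
- apply/matrixP => k a; rewrite !mxE.
  by rewrite (_ : lift i k == i = false) ?addr0// eq_sym (negPf (neq_lift _ _)).
- apply/matrixP => k a; rewrite !mxE.
  by rewrite eq_sym (negPf (neq_lift _ _)) addr0.
Qed.

End BetheDeterminant.

(** * Derivative and size of a determinant *)

Section DeterminantDerivative.
Context {R : realType}.

Lemma is_derive_bigsum (I : Type) (s : seq I) (f : I -> R -> R) (df : I -> R) (t : R) :
    (forall i, is_derive t (1 : R) (f i) (df i)) ->
  is_derive t (1 : R) (fun y => \sum_(i <- s) f i y) (\sum_(i <- s) df i).
Proof.
move=> fD; elim: s => [|i s IHs].
  rewrite big_nil (_ : (fun y => _) = cst 0); first exact: is_derive_cst.
  by apply/funext => y; rewrite big_nil.
rewrite big_cons (_ : (fun y => _) = f i + fun y => \sum_(j <- s) f j y).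
  exact: is_deriveD.
by apply/funext => y; rewrite big_cons.
Qed.

Lemma is_derive_bigprod n (f : 'I_n -> R -> R) (df : 'I_n -> R) (t : R) :
    (forall i, is_derive t (1 : R) (f i) (df i)) ->
  is_derive t (1 : R) (fun y => \prod_i f i y)
    (\sum_k \prod_i (if i == k then df i else f i t)).
Proof.
elim: n f df => [|n IHn] f df fD.
  rewrite big_ord0 (_ : (fun y => _) = cst 1); first exact: is_derive_cst.
  by apply/funext => y; rewrite big_ord0.
rewrite (_ : (fun y => _) = f ord0 * fun y => \prod_i f (lift ord0 i) y); last first.
  by apply/funext => y; rewrite big_ord_recl.
have D := IHn (fun i => f (lift ord0 i)) (fun i => df (lift ord0 i)) (fun i => fD _).
apply: (is_derive_eq (is_deriveM (fD ord0) D)).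
rewrite -[LHS]/(f ord0 t * _ + (\prod_i f (lift ord0 i) t) * df ord0).
rewrite big_ord_recl addrC; congr (_ + _).
  by rewrite big_ord_recl eqxx mulrC.
rewrite mulr_sumr; apply: eq_bigr => k _; rewrite big_ord_recl.
by congr (_ * _); apply: eq_bigr => i _; rewrite (inj_eq lift_inj).
Qed.

Lemma is_derive_det n (M : R -> 'M[R]_n) (dM : 'M[R]_n) (t : R) :
    (forall i j, is_derive t (1 : R) (fun y => M y i j) (dM i j)) ->
  is_derive t (1 : R) (fun y => \det (M y))
    (\sum_k \det (\matrix_(i, j) if i == k then dM i j else M t i j)).
Proof.
move=> MD; rewrite /determinant.
rewrite [X in is_derive _ _ _ X](_ : _ = \sum_(s : 'S_n) (-1) ^+ s *
    \sum_k \prod_i (if i == k then dM i (s i) else M t i (s i))); last first.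
  rewrite exchange_big/=; apply: eq_bigr => s _; rewrite mulr_sumr.
  by apply: eq_bigr => k _; congr (_ * _); apply: eq_bigr => i _; rewrite mxE.
apply: is_derive_bigsum => s.
exact: (is_deriveZ _ (is_derive_bigprod (fun i => MD i (s i)))).
Qed.

Lemma normr_det_le n (M : 'M[R]_n) (b : 'I_n -> R) :
    (forall i j, `|M i j| <= b i) ->
  `|\det M| <= n`!%:R * \prod_i b i.
Proof.
move=> Mb; apply: (le_trans (ler_norm_sum _ _ _)).
rewrite -[n`!](card_Sn n) -sum1_card natr_sum mulr_suml.
rewrite [leRHS](_ : _ = \sum_(s : 'S_n) \prod_i b i); last first.
  by apply: eq_big => s; rewrite ?inE// mul1r.
apply: ler_sum => s _; rewrite normrM normrX normrN1 expr1n mul1r normr_prod.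
by apply: ler_prod => i _; rewrite normr_ge0 Mb.
Qed.

End DeterminantDerivative.

(** * Row shifts, and the determinant for step initial data *)

Section BetheDeterminantShift.
Variable K : comNzRingType.

(** Linearity in row [k]. The left side is the [k]-th term of the time derivative of the determinant
    when [d/dt] acts on [F] as a forward difference. *)
Lemma det_bethe_mx_shift (F : nat -> int -> K) N (m : 'I_N -> int) (k : 'I_N) :
  \det (\matrix_(i, a) if i == k
      then F (N.-1 - i.-1)%N (m i - a%:Z + 1) - F (N.-1 - i.-1)%N (m i - a%:Z)
      else bethe_mx F m i a) =
  \det (bethe_mx F (fun i => m i + (i == k)%:R)) - \det (bethe_mx F m).
Proof.
set B := \matrix_(i, a) _.
rewrite (@determinant_multilinear _ _ B
  (bethe_mx F (fun i => m i + (i == k)%:R)) (bethe_mx F m) k 1 (-1)).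
- by rewrite mul1r mulN1r.
- apply/rowP => a; rewrite !mxE eqxx mul1r mulN1r; congr (F _ _ - _).
  by rewrite addrAC.
- apply/matrixP => i a; rewrite !mxE eq_sym (negPf (neq_lift _ _)).
  by rewrite addr0.
- by apply/matrixP => i a; rewrite !mxE eq_sym (negPf (neq_lift _ _)).
Qed.

(* By [Arec], [A p] is the [n]-th power of the backward difference of
   [A (p + n)]. *)
Lemma rec_expand (A : nat -> int -> K) :
    (forall p m, A p.+1 m - A p.+1 (m - 1) = A p m) ->
  forall n L p m, (n < L)%N ->
  \sum_(l < L) ((1 - 'X) ^+ n)`_l * A (p + n)%N (m - l%:Z) = A p m.
Proof.
move=> Arec; elim=> [|n IHn] [//|L] p m nL.
  rewrite big_ord_recl expr0 coef1 mul1r big1 ?addr0 ?addn0 ?subr0// => l _.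
  by rewrite coef1 mul0r.
rewrite -(Arec p m) -[in RHS](IHn L.+1 p.+1 m (ltnW nL)) -(IHn L p.+1 (m - 1) nL).
rewrite addnS addSn !big_ord_recl /= exprS mulrBl mul1r coefB coefXM subr0 -addrA.
congr (_ + _); rewrite -sumrB; apply: eq_bigr => l _.
by rewrite coefB coefXM /= mulrBl -[m - 1 - _]addrA -opprD /bump /= add1n -intS.
Qed.

Lemma det_antidiag n :
  \det (\matrix_(i < n, j < n) ((i + j).+1 == n)%:R) = (-1) ^+ 'C(n, 2) :> K.
Proof.
elim: n => [|n IHn]; first by rewrite det_mx00 bin_small.
rewrite (expand_det_row _ ord0) (bigD1 ord_max)//= big1 ?addr0; last first.
  move=> j; rewrite -val_eqE /= => jn; rewrite mxE add0n eqSS.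
  by rewrite (negPf jn) mul0r.
rewrite mxE eqxx mul1r /cofactor add0n binS bin1 exprD [RHS]mulrC.
congr (_ * _).
rewrite -IHn; congr (\det _); apply/matrixP => i j; rewrite !mxE.
congr (_%:R); rewrite /= /bump /= [(n <= j)%N]leqNgt ltn_ord add0n add1n addSn.
by rewrite eqSS.
Qed.

(** With unit spacing, subtracting [l] from the argument of row [k] gives the argument of row
    [k - l]. By [rec_expand], row [k] is thus a combination of the rows of [H] of index at most [k],
    all of order [N.-1], with leading coefficient 1. The matrix on the left is the transpose of [H]
    with its rows reversed, whence the sign. *)
Lemma det_bethe_mx_step (A : nat -> int -> K) N (x : int) :
    (forall p m, A p.+1 m - A p.+1 (m - 1) = A p m) ->
  \det (\matrix_(i < N, j < N) A N.-1 (N%:Z - x - i%:Z - j%:Z)) =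
  (-1) ^+ 'C(N, 2) * \det (bethe_mx A (fun k : 'I_N => k.+1%:Z - x)).
Proof.
move=> Arec.
pose H : 'M[K]_N := \matrix_(k, a) A N.-1 (k.+1%:Z - x - a%:Z).
pose U : 'M[K]_N := \matrix_(k, l)
  if (l <= k)%N then ((1 - 'X) ^+ k.-1)`_(k - l) else 0.
have -> : bethe_mx A (fun k : 'I_N => k.+1%:Z - x) = U *m H.
  apply/matrixP => k a; rewrite !mxE.
  rewrite -(@rec_expand A Arec k.-1 k.+1) ?ltnS ?leq_pred//.
  rewrite subnK; last by rewrite -!subn1 leq_sub2r// ltnW.
  rewrite (bigID (fun l : 'I_N => (l < k.+1)%N))/= [X in _ = _ + X]big1 ?addr0; last
      first.
    by move=> l; rewrite -ltnNge ltnS => kl; rewrite mxE leqNgt kl mul0r.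
  rewrite (eq_bigr (fun l : 'I_N => ((1 - 'X) ^+ k.-1)`_(k - l) *
    A N.-1 (l.+1%:Z - x - a%:Z))); last first.
    by move=> l; rewrite ltnS !mxE => ->.
  rewrite -(big_ord_widen _ (fun l => ((1 - 'X) ^+ k.-1)`_(k - l) *
    A N.-1 (l.+1%:Z - x - a%:Z))) ?ltn_ord//.
  rewrite (reindex_inj rev_ord_inj)/=; apply: eq_bigr => l _.
  have lk : (l <= k)%N by rewrite -ltnS.
  by congr (_`__ * A _ _); lia.
have -> : \matrix_(i < N, j < N) A N.-1 (N%:Z - x - i%:Z - j%:Z) =
    ((\matrix_(i < N, j < N) ((i + j).+1 == N)%:R) *m H)^T.
  apply/matrixP => i j; rewrite !mxE (bigD1 (rev_ord j))//= big1 ?addr0.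
    rewrite !mxE /= (_ : (j + (N - j.+1)).+1 == N); last first.
      by rewrite -addSn subnKC.
    rewrite mul1r; congr (A _ _); have := ltn_ord j; lia.
  move=> k kj; rewrite !mxE (_ : ((j + k).+1 == N) = false) ?mul0r//.
  apply: contra_neqF kj => /eqP jk; apply: val_inj => /=; lia.
have detU : \det U = 1.
  rewrite det_trig ?big1// => [k _|].
    by rewrite mxE leqnn subnn -horner_coef0 horner_exp !hornerE subr0 expr1n.
  by apply/is_trig_mxP => k l kl; rewrite mxE leqNgt kl.
by rewrite det_tr !det_mulmx det_antidiag detU mul1r.
Qed.

End BetheDeterminantShift.

(** * Uniqueness for the backward equation *)

(** The difference [g] of the two sides vanishes at 0 and has a nonnegative derivative. *)
Lemma le_of_derive_power (R : realType) (f df : R -> R) (T c : R) (k : nat) :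
    {within `[0, T], continuous f} ->
    (forall y : R, 0 < y < T -> is_derive y (1 : R) f (df y)) ->
    (forall y : R, 0 < y < T -> df y <= c * y ^+ k) -> f 0 = 0 ->
  forall t : R, 0 <= t <= T -> f t <= c / k.+1%:R * t ^+ k.+1.
Proof.
move=> fC fD dfB f0 t tT.
pose g : R -> R := (c / k.+1%:R) \*: (@id R ^+ k.+1) - f.
have gE y : g y = c / k.+1%:R * y ^+ k.+1 - f y by rewrite /g !fctE.
have gD (y : R) : 0 < y < T -> is_derive y (1 : R) g (c * y ^+ k - df y).
  move=> yT; have fDy := fD y yT.
  have idD := is_deriveX k (is_derive_id (y : R^o) (1 : R^o)).
  apply: (is_derive_eq (is_deriveB (is_deriveZ (c / k.+1%:R)
    (is_deriveX k.+1 (is_derive_id (y : R^o) (1 : R^o)))) fDy)).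
  rewrite /GRing.scale /= mulr1 mulrA; congr (_ * _ - _).
  by rewrite divfK// pnatr_eq0.
have gC : {within `[0, T], continuous g}.
  apply: within_continuousB fC; apply: continuous_subspaceT => y.
  by apply/differentiable_continuous/derivable1_diffP.
have T0 : 0 <= T by case/andP: tT => /le_trans; exact.
have dg (y : R) : y \in `]0, T[ -> derivable g y 1.
  by rewrite in_itv/= => /gD[].
have dg_ge0 (y : R) : y \in `]0, T[ -> 0 <= derive1 g y.
  rewrite in_itv/= => yT; rewrite derive1E; have gDy := gD _ yT.
  by rewrite derive_val subr_ge0 dfB.
have T0m : 0 \in `[0, T] by rewrite in_itv/= lexx.
have Ttm : t \in `[0, T] by rewrite in_itv.
have t_ge0 : 0 <= t by case/andP: tT.
have := @ger0_derive1_le_cc R g 0 T dg dg_ge0 gC 0 t T0m Ttm t_ge0.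
by rewrite !gE f0 expr0n mulr0 subrr subr_ge0.
Qed.

Section WeightedUniqueness.
Variables (R : realType) (S : Type) (n : nat) (a : 'I_n -> S -> S).
Variables (w : S -> R) (rho : R).
Hypothesis rho_ge0 : 0 <= rho.
Hypothesis w_step : forall i s, w (a i s) <= rho * w s.

(* The weight [w] allows for solutions that grow exponentially in space: Picard
   iteration bounds [v] by [K w(s) (C t)^k / k!] for all [k]. *)
Lemma weighted_uniqueness (v : R -> S -> R) (T K : R) :
    0 <= K ->
    (forall s, {within `[0, T], continuous (v ^~ s)}) ->
    (forall s (t : R), 0 < t < T ->
      is_derive t (1 : R) (v ^~ s) (\sum_(i < n) (v t (a i s) - v t s))) ->
    (forall s, v 0 s = 0) ->
    (forall s (t : R), 0 <= t <= T -> `|v t s| <= K * w s) ->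
  forall s (t : R), 0 <= t <= T -> v t s = 0.
Proof.
move=> K_ge0 vC vD v0 vK.
(* Each of the [n] differences [v t (a i s) - v t s] costs a factor [rho] for the moved state and 1
   for [s]. *)
have [C CE] : exists C, C = n%:R * (rho + 1) by eexists.
have C_ge0 : 0 <= C by rewrite CE mulr_ge0// addr_ge0.
have bnd k s (t : R) : 0 <= t <= T -> `|v t s| <= K * w s * C ^+ k / k`!%:R * t ^+ k.
  elim: k s t => [|k IHk] s t tT.
    by rewrite !expr0 fact0 divr1 !mulr1; exact: vK.
  have [b bE'] : exists b, b = K * w s * C ^+ k.+1 / k`!%:R by eexists.
  have bE : K * w s * C ^+ k.+1 / (k.+1)`!%:R = b / k.+1%:R.
    by rewrite bE' factS natrM invfM mulrCA mulrC.
  have dB (y : R) : 0 < y < T -> `|\sum_(i < n) (v y (a i s) - v y s)| <= b * y ^+ k.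
    move=> y0T; have yT' : 0 <= y <= T by case/andP: y0T => *; rewrite !ltW.
    apply: (le_trans (ler_norm_sum _ _ _)).
    apply: (@le_trans _ _ (\sum_(i < n)
        ((rho + 1) * (K * w s * C ^+ k / k`!%:R * y ^+ k)))); last first.
      rewrite sumr_const card_ord -[_ *+ n]mulr_natl mulrA -CE bE' exprS.
      by rewrite !mulrA [C * K]mulrC -!mulrA [C * (w s * _)]mulrCA.
    apply: ler_sum => i _; apply: (le_trans (ler_normB _ _)).
    rewrite mulrDl mul1r; apply: lerD; last exact: IHk.
    apply: (le_trans (IHk _ _ yT')).
    have /andP[/ltW y_ge0 _] := y0T.
    have D_ge0 : 0 <= K * (C ^+ k / k`!%:R * y ^+ k).
      by rewrite !mulr_ge0// ?exprn_ge0// invr_ge0.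
    have DE z : K * z * C ^+ k / k`!%:R * y ^+ k = K * (C ^+ k / k`!%:R * y ^+ k) * z.
      by rewrite -!mulrA [z * _]mulrC !mulrA.
    by rewrite !DE [rho * _]mulrCA; exact: ler_wpM2l.
  (* The comparison is one-sided, so it is applied to [v] and to [- v]. *)
  rewrite bE ler_norml lerNl; apply/andP; split; last first.
    apply: (@le_of_derive_power _ _ _ T b k (vC s) (vD s)) => // y yT.
    exact: le_trans (ler_norm _) (dB y yT).
  apply: (@le_of_derive_power _ (- (v ^~ s)) (fun y => - \sum_(i < n) (v y (a i s) -
      v y s)) T b k) => //.
  - by move=> y; apply: cvgN; exact: vC.
  - by move=> y yT; have vDy := vD s y yT; exact: is_deriveN.
  - by move=> y yT; apply: le_trans (dB y yT); rewrite -normrN ler_norm.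
  - by rewrite fctE v0 oppr0.
move=> s t tT; apply/eqP; rewrite -normr_le0.
(* The bounds of [bnd] are terms of an exponential series and hence tend to 0. *)
have lim0 : K * w s * exp_coeff (C * t) k @[k --> \oo] --> K * w s * 0.
  apply: cvgMr; exact: cvg_exp_coeff.
rewrite mulr0 in lim0; apply: (cvgr_to_ge lim0); apply: nearW => k.
by rewrite /exp_coeff /= exprMn [_ * t ^+ k / _]mulrAC !mulrA bnd.
Qed.
End WeightedUniqueness.

(** * Contour integrals *)

Section ComplexFacts.
Context {R : realType}.
Implicit Types (z w g : R[i]) (f h : R -> R[i]).
Local Notation normc := (@Normc.normc R).

Lemma normr_Re_le z : `|complex.Re z| <= normc z.
Proof.
by case: z => a b /=; rewrite -sqrtr_sqr ler_wsqrtr// lerDl sqr_ge0.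
Qed.

Lemma normc_ge0 z : 0 <= normc z.
Proof. by apply: le_trans (normr_Re_le z); rewrite normr_ge0. Qed.

Lemma normc_real (x : R) : normc x%:C = `|x|.
Proof. by rewrite /= expr0n addr0 sqrtr_sqr. Qed.

Lemma normcX z n : normc (z ^+ n) = normc z ^+ n.
Proof.
by elim: n => [|n IHn]; rewrite ?Normc.normc1// !exprS Normc.normcM IHn.
Qed.

Lemma normcXz z (k : int) : normc (z ^ k) = normc z ^ k.
Proof.
by case: k => n; rewrite ?NegzE ?exprnN -?exprnP ?Normc.normcV normcX.
Qed.

Lemma normc_cexp z : normc (cexp z) = expR (complex.Re z).
Proof.
rewrite /cexp Normc.normcM normc_real ger0_norm ?expR_ge0//=.
by rewrite cos2Dsin2 sqrtr1 mulr1.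
Qed.

Lemma cexp0 : cexp 0 = 1 :> R[i].
Proof. by rewrite /cexp /= expR0 cos0 sin0 mul1r. Qed.

Lemma cexp_imE (u : R) : cexp (0 +i* u) = cos u +i* sin u.
Proof. by rewrite /cexp /= expR0 mul1r. Qed.

(** De Moivre's formula; on the unit circle the conjugate is the inverse, which covers negative
    [k]. *)
Lemma cexp_imX (u : R) (k : int) :
  cexp (0 +i* u) ^ k = cos (k%:~R * u) +i* sin (k%:~R * u).
Proof.
have X n : cexp (0 +i* u) ^+ n = cos (n%:R * u) +i* sin (n%:R * u).
  elim: n => [|n IHn]; first by rewrite mul0r cos0 sin0.
  rewrite exprS IHn cexp_imE -natr1 mulrDl mul1r cosD sinD.
  by apply/eqP; rewrite eq_complex /=; apply/andP; split; apply/eqP; ring.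
case: k => n; first by rewrite -exprnP X.
rewrite NegzE -exprnN X mulrNz mulNr cosN sinN; apply: mulr1_eq.
apply/eqP; rewrite eq_complex /= mulrN opprK -!expr2 cos2Dsin2 eqxx/=.
by rewrite mulrN addrC mulrC subrr.
Qed.

Lemma is_derive_Re_cexp g w (t : R) :
  is_derive t (1 : R) (fun t => complex.Re (g * cexp (w * t%:C)))
    (complex.Re (g * w * cexp (w * t%:C))).
Proof.
case: g w => [x y] [a b].
have linD (k : R) : is_derive t (1 : R) (k \*: @id R) k.
  apply: (is_derive_eq (is_deriveZ k (is_derive_id t (1 : R)))).
  exact: mulr1.
have expD := is_derive1_comp (is_derive_expR (a * t)) (linD a).
have cosD := is_derive1_comp (is_derive_cos (b * t)) (linD b).
have sinD := is_derive1_comp (is_derive_sin (b * t)) (linD b).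
rewrite [X in is_derive _ _ X _](_ : _ = (expR \o (a \*: @id R)) *
    (x \*: (cos \o (b \*: @id R)) - y \*: (sin \o (b \*: @id R)))); last first.
  apply/funext => v; rewrite fctE /cexp.
  rewrite -[RHS]/(expR (a * v) * (x * cos (b * v) - y * sin (b * v))) /=.
  by rewrite !mulr0 !mul0r !(subr0, addr0, add0r); ring.
apply: (is_derive_eq (is_deriveM expD (is_deriveB (is_deriveZ x cosD) (is_deriveZ y
    sinD)))).
rewrite -[LHS]/(expR (a * t) * (x * (- sin (b * t) * b) - y * (cos (b * t) * b)) +
  (x * cos (b * t) - y * sin (b * t)) * (expR (a * t) * a)) /cexp /=.
by rewrite !mulr0 !mul0r !(subr0, addr0, add0r); ring.
Qed.

(** Continuity is taken componentwise, so that only continuity of real functions is involved. *)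
Definition ccontinuous f :=
  continuous (fun u => complex.Re (f u)) /\
  continuous (fun u => complex.Im (f u)).

Lemma ccontinuous_cst z : ccontinuous (fun=> z).
Proof. by split=> u; exact: cvg_cst. Qed.

Lemma ccontinuousM f h :
  ccontinuous f -> ccontinuous h -> ccontinuous (fun u => f u * h u).
Proof.
move=> [f1 f2] [h1 h2]; split.
  rewrite (_ : (fun u => _) = (fun u => complex.Re (f u) * complex.Re (h u) -
      complex.Im (f u) * complex.Im (h u))); last first.
    by apply/funext => u; case: (f u) (h u) => [? ?] [? ?].
  by move=> u; apply: cvgB; apply: cvgM; (exact: f1 || exact: f2 || exact: h1 ||
      exact: h2).
rewrite (_ : (fun u => _) = (fun u => complex.Re (f u) * complex.Im (h u) +
    complex.Im (f u) * complex.Re (h u))); last first.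
  by apply/funext => u; case: (f u) (h u) => [? ?] [? ?].
by move=> u; apply: cvgD; apply: cvgM; (exact: f1 || exact: f2 || exact: h1 || exact: h2).
Qed.

Lemma ccontinuousB f h :
  ccontinuous f -> ccontinuous h -> ccontinuous (fun u => f u - h u).
Proof.
move=> [f1 f2] [h1 h2]; split.
  rewrite (_ : (fun u => _) = (fun u => complex.Re (f u) - complex.Re (h u))); last first.
    by apply/funext => u; case: (f u) (h u) => [? ?] [? ?].
  by move=> u; apply: cvgB; (exact: f1 || exact: f2 || exact: h1 || exact: h2).
rewrite (_ : (fun u => _) = (fun u => complex.Im (f u) - complex.Im (h u))); last first.
  by apply/funext => u; case: (f u) (h u) => [? ?] [? ?].
by move=> u; apply: cvgB; (exact: f1 || exact: f2 || exact: h1 || exact: h2).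
Qed.

Lemma ccontinuousX f n : ccontinuous f -> ccontinuous (fun u => f u ^+ n).
Proof.
move=> fC; elim: n => [|n IHn]; first exact: ccontinuous_cst.
under eq_fun do rewrite exprS; exact: ccontinuousM.
Qed.

Lemma ccontinuousV f : (forall u, f u != 0) ->
  ccontinuous f -> ccontinuous (fun u => (f u)^-1).
Proof.
move=> f0 [f1 f2].
have nC : continuous (fun u => (complex.Re (f u) ^+ 2 + complex.Im (f u) ^+ 2)^-1).
  move=> u; apply: cvgV; last by apply: cvgD; rewrite ?expr2; under eq_fun do rewrite
      expr2; apply: cvgM; (exact: f1 || exact: f2).
  by have := f0 u; case: (f u) => a b; rewrite eq_complex /= paddr_eq0 ?sqr_ge0//
      !sqrf_eq0.
split.
  rewrite (_ : (fun u => _) = (fun u => complex.Re (f u) * (complex.Re (f u) ^+ 2 +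
      complex.Im (f u) ^+ 2)^-1)); last first.
    by apply/funext => u; case: (f u).
  by move=> u; apply: cvgM; [exact: f1|exact: nC].
rewrite (_ : (fun u => _) = (fun u => - (complex.Im (f u) * (complex.Re (f u) ^+ 2 +
    complex.Im (f u) ^+ 2)^-1))); last first.
  by apply/funext => u; case: (f u).
by move=> u; apply: cvgN; apply: cvgM; [exact: f2|exact: nC].
Qed.

Lemma ccontinuousXz f (k : int) : (forall u, f u != 0) ->
  ccontinuous f -> ccontinuous (fun u => f u ^ k).
Proof.
move=> f0 fC; case: k => n; first exact: ccontinuousX.
under eq_fun do rewrite NegzE -exprnN.
apply: ccontinuousV; last exact: ccontinuousX.
by move=> u; rewrite expf_neq0.
Qed.

Lemma ccontinuous_cexp f : ccontinuous f -> ccontinuous (fun u => cexp (f u)).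
Proof.
move=> [f1 f2]; apply: ccontinuousM; split => u /=.
- by apply: continuous_comp; [exact: f1|exact: continuous_expR].
- exact: cvg_cst.
- by apply: continuous_comp; [exact: f2|exact: continuous_cos].
- by apply: continuous_comp; [exact: f2|exact: continuous_sin].
Qed.

End ComplexFacts.

(** * Real integrals, and vanishing by geometric decay *)

Section RealFacts.
Context {R : realType}.

Lemma is_derive_within_continuous (f df : R -> R) (A : set R) :
    (forall x : R, is_derive x (1 : R) f (df x)) ->
  {within A, continuous f}.
Proof.
move=> fD; apply: continuous_subspaceT => y; have fDy := fD y.
by apply/differentiable_continuous/derivable1_diffP.
Qed.

Lemma continuous_itv_integrable (f : R -> R) (a b : R) :
  continuous f -> lebesgue_measure.-integrable `[a, b] (EFin \o f).
Proof.
move=> fC; apply: continuous_compact_integrable; first exact: segment_compact.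
exact: continuous_subspaceT.
Qed.

Lemma Rintegral_cst_itv (a b c : R) : a < b ->
  \int[lebesgue_measure]_(x in `[a, b]) c = c * (b - a).
Proof.
move=> ab; have muE := lebesgue_measure_itv `[a, b].
by rewrite /= lte_fin ab in muE; rewrite Rintegral_cst// [X in fine X]muE.
Qed.

Lemma Rintegral_periodic_derivative (f F : R -> R) (a b : R) : a < b ->
    continuous f -> (forall x : R, is_derive x (1 : R) F (f x)) -> F a = F b ->
  \int[lebesgue_measure]_(x in `[a, b]) f x = 0.
Proof.
move=> ab fC FD Fab.
have FC : continuous F.
  by move=> y; have FDy := FD y; apply/differentiable_continuous/derivable1_diffP.
rewrite /Rintegral (@continuous_FTC2 _ f F a b ab).
- by rewrite Fab /= subrr.
- exact: continuous_subspaceT.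
- split.
  + by move=> y _; have [] := FD y.
  + exact/cvg_at_right_filter/FC.
  + exact/cvg_at_left_filter/FC.
- by move=> y _; rewrite derive1E; have FDy := FD y; rewrite derive_val.
Qed.

(** By induction [B p] vanishes to the left of 0, so the recursion makes [B p.+1] constant there,
    while its bound decays as the argument goes to minus infinity. This takes the place of Cauchy's
    theorem for the contour integrals at time 0. *)
Lemma geometric_decay_eq0 (r : R) (B : nat -> int -> R) (K : nat -> R) :
    0 < r < 1 ->
    (forall p m, B p.+1 m - B p.+1 (m - 1) = B p m) ->
    (forall m : int, m < 0 -> B 0%N m = 0) ->
    (forall p m, `|B p m| <= K p * r ^ (- m)) ->
  forall p (m : int), m < 0 -> B p m = 0.
Proof.
move=> /andP[r0 r1] Brec B0 BK; elim=> [//|p IHp] m m0.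
have shift n : B p.+1 m = B p.+1 (m - n%:Z).
  elim: n => [|n IHn]; first by rewrite subr0.
  apply/eqP; rewrite IHn -subr_eq0.
  rewrite (_ : m - n.+1%:Z = m - n%:Z - 1) ?Brec ?IHp//; lia.
apply/eqP; rewrite -normr_le0.
have lim0 : K p.+1 * r ^ (- m) * r ^+ n @[n --> \oo] --> K p.+1 * r ^ (- m) * 0.
  by apply: cvgMr; apply: cvg_expr; rewrite ger0_norm// ltW.
rewrite mulr0 in lim0; apply: (cvgr_to_ge lim0); apply: nearW => n.
rewrite (shift n) (le_trans (BK _ _))// opprB addrC exprzDr ?unitfE ?gt_eqF//.
by rewrite -exprnP mulrA.
Qed.

End RealFacts.

(** * The contour integrals as real functions of time *)

Section ContourIntegrals.
Context {R : realType}.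
Variable r : R.
Hypotheses (hr0 : 0 < r) (hr1 : r < 1).
Local Notation normc := (@Normc.normc R).
Local Notation mu := (@lebesgue_measure R).

Definition circ (u : R) : R[i] := r%:C * cexp (0 +i* u).

(** On the circle [dxi = i xi du]: this turns the exponent [-1-m] into [-m] and cancels the [i] of
    [2 pi i]. *)
Definition contour_integrand (c : R[i]) (p : nat) (m : int) (t u : R) : R :=
  complex.Re (c * circ u ^ (- m) * (1 - circ u) ^- p *
              cexp (((circ u)^-1 - 1) * t%:C)).

(* The real part of [c / (2 pi i)] times the integral of
   [xi^(-1-m) (1 - xi)^(-p) exp((1/xi - 1) t)] along the circle; [c = 1] and
   [c = - 'i] give the real and the imaginary part. *)
Definition contour (c : R[i]) (p : nat) (m : int) (t : R) : R :=
  (2 * pi)^-1 * \int[mu]_(u in `[0, 2 * pi]) contour_integrand c p m t u.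

Lemma normc_circ u : normc (circ u) = r.
Proof.
by rewrite Normc.normcM normc_real normc_cexp expR0 mulr1 ger0_norm// ltW.
Qed.

Lemma circ_neq0 u : circ u != 0.
Proof.
by apply/eqP => u0; have := normc_circ u; rewrite u0 Normc.normc0 => /eqP; rewrite lt_eqF.
Qed.

Lemma normc_1Bcirc_ge u : 1 - r <= normc (1 - circ u).
Proof.
have := le_normcD (1 - circ u) (circ u).
by rewrite subrK Normc.normc1 normc_circ lerBlDr.
Qed.

Lemma subr1_circ_neq0 u : 1 - circ u != 0.
Proof.
apply/eqP => u0; have := normc_1Bcirc_ge u.
by rewrite u0 Normc.normc0 subr_le0 leNgt hr1.
Qed.

Lemma ccontinuous_circ : ccontinuous circ.
Proof.
apply: ccontinuousM; first exact: ccontinuous_cst.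
by apply: ccontinuous_cexp; split => u; [exact: cvg_cst|exact: cvg_id].
Qed.

Lemma contour_integrand_continuous c p m t :
  continuous (contour_integrand c p m t).
Proof.
have circC := ccontinuous_circ.
have BC : ccontinuous (fun u => 1 - circ u).
  by apply: ccontinuousB => //; exact: ccontinuous_cst.
suff [] : ccontinuous (fun u => c * circ u ^ (- m) * (1 - circ u) ^- p *
              cexp (((circ u)^-1 - 1) * t%:C)) by [].
apply: ccontinuousM; last first.
  apply: ccontinuous_cexp; apply: ccontinuousM; last exact: ccontinuous_cst.
  apply: ccontinuousB; last exact: ccontinuous_cst.
  exact: ccontinuousV circ_neq0 circC.
apply: ccontinuousM; last first.
  apply: ccontinuousV; last exact: ccontinuousX.
  by move=> u; rewrite expf_neq0// subr1_circ_neq0.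
apply: ccontinuousM; first exact: ccontinuous_cst.
exact: ccontinuousXz circ_neq0 circC.
Qed.

Lemma contour_integrand_integrable c p m t :
  mu.-integrable `[0, 2 * pi] (EFin \o contour_integrand c p m t).
Proof. exact/continuous_itv_integrable/contour_integrand_continuous. Qed.

Definition contour_bound (c : R[i]) (p : nat) (m : int) (T : R) : R :=
  normc c * (1 - r) ^- p * expR ((r^-1 + 1) * T) * r ^ (- m).

Lemma contour_integrand_bound c p m t T u : `|t| <= T ->
  `|contour_integrand c p m t u| <= contour_bound c p m T.
Proof.
move=> tT; apply: (le_trans (normr_Re_le _)).
rewrite 3!Normc.normcM normcXz normc_circ Normc.normcV normcX normc_cexp.
rewrite /contour_bound -!mulrA ler_wpM2l ?normc_ge0// mulrC -!mulrA.
apply: ler_pM.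
- by rewrite invr_ge0 exprn_ge0// normc_ge0.
- by rewrite mulr_ge0 ?expR_ge0// exprz_ge0// ltW.
- rewrite lef_pV2 ?posrE ?exprn_gt0 ?subr_gt0//; last first.
    by rewrite (lt_le_trans _ (normc_1Bcirc_ge u))// subr_gt0.
  by rewrite lerXn2r ?nnegrE ?normc_ge0 ?subr_ge0 ?normc_1Bcirc_ge// ltW.
apply: ler_wpM2r; first by rewrite exprz_ge0// ltW.
rewrite ler_expR.
apply: (le_trans (ler_norm _)); apply: (le_trans (normr_Re_le _)).
rewrite Normc.normcM normc_real ler_pM ?normc_ge0//.
apply: (le_trans (le_normcD _ _)).
by rewrite normcN Normc.normcV normc_circ Normc.normc1.
Qed.

Lemma contour_boundP c p m t T : `|t| <= T ->
  `|contour c p m t| <= contour_bound c p m T.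
Proof.
move=> tT; have pi2_gt0 : 0 < 2 * pi :> R by rewrite mulr_gt0// pi_gt0.
rewrite normrM ger0_norm ?invr_ge0 ?(ltW pi2_gt0)// mulrC ler_pdivrMr//.
apply: (le_trans (le_normr_Rintegral _ (contour_integrand_integrable _ _ _ _))) => //.
apply: (@le_trans _ _ (\int[mu]_(u in `[0, 2 * pi]) contour_bound c p m T)).
  apply: le_Rintegral => //.
  - apply: continuous_itv_integrable => u.
    by apply: cvg_norm; exact: contour_integrand_continuous.
  - by apply: continuous_itv_integrable => u; exact: cvg_cst.
  - by move=> u _; exact: contour_integrand_bound.
by rewrite Rintegral_cst_itv// subr0.
Qed.

(** The difference of the two powers of [xi] is [xi^(-m) (1 - xi)], which cancels one factor of the
    denominator. *)
Lemma contour_rec c p m t :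
  contour c p.+1 m t - contour c p.+1 (m - 1) t = contour c p m t.
Proof.
rewrite /contour -mulrBr -RintegralB//; try exact: contour_integrand_integrable.
congr (_ * _); apply: eq_Rintegral => u _; rewrite /contour_integrand.
rewrite -[LHS](raddfB (@complex.Re R : Rcomplex R -> R)).
congr complex.Re; rewrite opprB addrC exprzDr ?unitfE ?circ_neq0// expr1z.
rewrite exprS invfM [in RHS](_ : (1 - circ u) ^- p =
  (1 - circ u) * ((1 - circ u)^-1 * (1 - circ u) ^- p)); last first.
  by rewrite mulVKf// subr1_circ_neq0.
by ring.
Qed.

(** Differentiating the exponential produces the factor [1/xi - 1], and multiplication by [1/xi]
    raises [m] by one. *)
Lemma is_derive_contour c p m t :
  is_derive t (1 : R) (contour c p m) (contour c p (m + 1) t - contour c p m t).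
Proof.
have dE (x u : R) : is_derive x (1 : R) (fun t => contour_integrand c p m t u)
    (contour_integrand c p (m + 1) x u - contour_integrand c p m x u).
  apply: is_derive_eq; first exact: is_derive_Re_cexp.
  rewrite -[RHS](raddfB (@complex.Re R : Rcomplex R -> R)).
  congr complex.Re; rewrite opprD exprzDr ?unitfE ?circ_neq0// exprN1.
  by ring.
have pE (x u : R) : partial1of2 (contour_integrand c p m) x u =
    contour_integrand c p (m + 1) x u - contour_integrand c p m x u.
  by rewrite partial1of2E; have dExu := dE x u; rewrite derive_val.
(* Times in []t - 1, t + 1[] are bounded by this [T], so the constant [G] dominates the time
   derivative of the integrand there. *)
pose T := `|t| + 1.
have It : (`]t - 1, t + 1[%classic : set R) t by rewrite /= in_itv/=; apply/andP;
    split; lra.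
pose G (u : R) := contour_bound c p (m + 1) T + contour_bound c p m T.
have bound_ge0 k : 0 <= contour_bound c p k T.
  by apply: le_trans (contour_boundP c p k (_ : `|0| <= T)); rewrite ?normr0 ?addr_ge0.
have G0 u : 0 <= G u by rewrite addr_ge0.
have Gint : mu.-integrable `[0, 2 * pi] (EFin \o G).
  by apply: continuous_itv_integrable => u; exact: cvg_cst.
have GB (x u : R) : (`]t - 1, t + 1[%classic : set R) x -> (`[0, 2 * pi]%classic :
    set R) u ->
    `|partial1of2 (contour_integrand c p m) x u| <= G u.
  rewrite /= in_itv/= => /andP[x1 x2] _; rewrite pE (le_trans (ler_normB _ _))//.
  have xT : `|x| <= T.
    rewrite -[x](subrK t) (le_trans (ler_normD _ _))// addrC lerD2l.
    by rewrite ler_norml; apply/andP; split; lra.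
  by rewrite lerD// contour_integrand_bound.
have intf (x : R) : (`]t - 1, t + 1[%classic : set R) x ->
    mu.-integrable `[0, 2 * pi] (EFin \o contour_integrand c p m x).
  by move=> _; exact: contour_integrand_integrable.
have derf (x u : R) : (`]t - 1, t + 1[%classic : set R) x -> (`[0, 2 * pi]%classic :
    set R) u ->
    derivable (contour_integrand c p m ^~ u) x 1.
  by move=> _ _; have [] := dE x u.
have mI := measurable_itv (`[0, 2 * pi] : interval R).
have D1 := @derivable_under_integral R _ _ mu
  (contour_integrand c p m) _ mI t (t - 1) (t + 1) It intf derf G G0 Gint GB.
have D2 := @differentiation_under_integral R _ _ mu
  (contour_integrand c p m) _ mI t (t - 1) (t + 1) It intf derf G G0 Gint GB.
have D : is_derive t (1 : R) (fun x => \int[mu]_(u in `[0, 2 * pi]) contour_integrand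
    c p m x u)
    (\int[mu]_(u in `[0, 2 * pi]) partial1of2 (contour_integrand c p m) t u).
  by apply: DeriveDef; [exact: D1|rewrite -derive1E; exact: D2].
apply: (is_derive_eq (is_deriveZ (2 * pi)^-1 D)).
rewrite -[LHS]/((2 * pi)^-1 * _) /contour -mulrBr; congr (_ * _).
rewrite -RintegralB//; try exact: contour_integrand_integrable.
by apply: eq_Rintegral => u _; rewrite pE.
Qed.

(** Orthogonality of Fourier modes: the integrand is a single mode of frequency [- m], and its
    integral over a period is 0 unless [m = 0]. *)
Lemma contour_initial0 c m : contour c 0 m 0 = complex.Re c * (m == 0)%:R.
Proof.
have pi2_gt0 : 0 < 2 * pi :> R by rewrite mulr_gt0// pi_gt0.
pose k := - m.
have iE u : contour_integrand c 0 m 0 u = r ^ k *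
    (complex.Re c * cos (k%:~R * u) - complex.Im c * sin (k%:~R * u)).
  rewrite /contour_integrand mulr0 cexp0 expr0 invr1 !mulr1 /circ expfzMl.
  rewrite cexp_imX -/k -(rmorphXz (real_complex R)) ?unitfE ?gt_eqF//.
  by case: c => x y /=; rewrite !mul0r subr0 addr0; ring.
rewrite /contour; have [m0|m0] := eqVneq m 0.
  have -> : \int[mu]_(u in `[0, 2 * pi]) contour_integrand c 0 m 0 u =
            \int[mu]_(u in `[0, 2 * pi]) complex.Re c.
    apply: eq_Rintegral => u _.
    by rewrite iE /k m0 oppr0 mul0r cos0 sin0 mulr0 subr0 mul1r mulr1.
  rewrite Rintegral_cst_itv// subr0 mulr1.
  by rewrite mulrC mulfK// gt_eqF.
have k0 : k%:~R != 0 :> R by rewrite intr_eq0 oppr_eq0.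
pose F u := r ^ k / k%:~R *
  (complex.Re c * sin (k%:~R * u) + complex.Im c * cos (k%:~R * u)).
have FD (u : R) : is_derive u (1 : R) F (contour_integrand c 0 m 0 u).
  have linD : is_derive u (1 : R) (k%:~R \*: @id R) (k%:~R : R).
    apply: (is_derive_eq (is_deriveZ _ (is_derive_id u (1 : R)))).
    exact: mulr1.
  have cosD := is_derive1_comp (is_derive_cos (k%:~R * u)) linD.
  have sinD := is_derive1_comp (is_derive_sin (k%:~R * u)) linD.
  apply: (is_derive_eq (is_deriveZ (r ^ k / k%:~R)
    (is_deriveD (is_deriveZ (complex.Re c) sinD) (is_deriveZ (complex.Im c) cosD)))).
  rewrite -[LHS]/(r ^ k / k%:~R * (complex.Re c * (cos (k%:~R * u) * k%:~R) +
    complex.Im c * (- sin (k%:~R * u) * k%:~R))) iE.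
  by move: (k%:~R : R) k0 (r ^ k) => q q0 y; field.
have F2pi : F 0 = F (2 * pi).
  have : cexp (0 +i* (2 * pi)) ^ k = 1 :> R[i].
    by rewrite cexp_imE mulr_natl cos2pi sin2pi exp1rz.
  by rewrite cexp_imX /F => -[-> ->]; rewrite mulr0 cos0 sin0.
have fC := contour_integrand_continuous (c := c) (p := 0%N) (m := m) (t := 0).
by rewrite (Rintegral_periodic_derivative pi2_gt0 fC FD F2pi) !mulr0.
Qed.

Lemma contour_initial_neg c p m : m < 0 -> contour c p m 0 = 0.
Proof.
apply: (@geometric_decay_eq0 _ r (fun p m => contour c p m 0)
  (fun p => normc c * (1 - r) ^- p * expR ((r^-1 + 1) * 0))).
- by rewrite hr0.
- by move=> *; exact: contour_rec.
- by move=> k k0; rewrite contour_initial0 lt_eqF// mulr0.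
- by move=> *; rewrite contour_boundP// normr0.
Qed.

(** The recursion carries the value 0 upwards from negative [m], once order [p] is known to
    vanish. *)
Lemma contour_im_initial p m : contour (- 'i) p m 0 = 0.
Proof.
elim: p m => [|p IHp] m; first by rewrite contour_initial0 /= oppr0 mul0r.
have [m0|m0] := ltP m 0; first exact: contour_initial_neg.
case: m m0 => // n _; elim: n => [|n IHn].
  have := contour_rec (- 'i) p 0 0.
  by rewrite IHp [X in _ - X]contour_initial_neg// subr0.
have := contour_rec (- 'i) p n.+1 0.
by rewrite IHp (_ : n.+1%:Z - 1 = n%:Z) ?IHn ?subr0//; lia.
Qed.

Lemma contour_weight (m : int) : r ^ (- m) <= r^-1 ^+ `|m|%N.
Proof.
have r1 : 1 <= r^-1 by rewrite invf_ge1// ltW.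
case: m => n; first by rewrite -exprnN exprVn.
rewrite NegzE opprK -exprnP abszN absz_nat.
rewrite (@le_trans _ _ 1)//; first by rewrite exprn_ile1// ltW.
by rewrite exprn_ege1.
Qed.

Lemma weight_shift (m k : int) :
  r^-1 ^+ `|(m + k)%R|%N <= r^-1 ^+ `|k|%N * r^-1 ^+ `|m|%N.
Proof.
rewrite -exprD ler_weXn2l ?invf_ge1 1?ltW//; lia.
Qed.

(** For fixed [p] the imaginary parts solve the backward equation of a walk on the integers with the
    single move [k + 1], with zero initial values. Uniqueness makes them vanish. *)
Lemma contour_im p m t : 0 <= t -> contour (- 'i) p m t = 0.
Proof.
move=> t0; pose a (_ : 'I_1) (k : int) := k + 1.
pose w (k : int) := r^-1 ^+ `|k|%N.
pose K := normc (- 'i) * (1 - r) ^- p * expR ((r^-1 + 1) * t).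
have K0 : 0 <= K.
  rewrite !mulr_ge0 ?normc_ge0 ?expR_ge0// invr_ge0 exprn_ge0// subr_ge0.
  exact: ltW.
apply: (@weighted_uniqueness R int 1 a w r^-1 _ _ (fun t m => contour (- 'i) p m t) t
    K K0) => //.
- by rewrite invr_ge0 ltW.
- by move=> i k; rewrite /a /w (le_trans (weight_shift _ _)).
- by move=> k; apply: is_derive_within_continuous => x; exact: is_derive_contour.
- by move=> k x _; rewrite big_ord1; exact: is_derive_contour.
- by move=> k; exact: contour_im_initial.
- move=> k x /andP[x0 xt]; apply: (le_trans (contour_boundP _ _ _ (_ : _ <= t))).
    by rewrite ger0_norm.
  by rewrite ler_wpM2l// contour_weight.
- by rewrite t0 lexx.
Qed.

End ContourIntegrals.

(** * Regularity of transition probabilities *)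

Section EsumFacts.
Context {R : realType}.
Local Open Scope ereal_scope.

Lemma esumZl (T : choiceType) (I : set T) (k : R) (a : T -> \bar R) :
    (0 <= k)%R -> (forall i, 0 <= a i) ->
  \esum_(i in I) (k%:E * a i) = k%:E * \esum_(i in I) a i.
Proof.
move=> k0 a0; rewrite /esum -ereal_supZl//; last first.
  apply/set0P; exists 0; exists set0; first exact: fsets_set0.
  by rewrite fsbig_set0.
congr ereal_sup; apply/seteqP; split => [_ [X [finX XI] <-]|_ [_ [X [finX XI] <-] <-]].
  exists (\sum_(i \in X) a i); first by exists X.
  by rewrite ge0_mule_fsumr.
by exists X => //; rewrite ge0_mule_fsumr.
Qed.

Lemma esum_exchange (T1 T2 : choiceType) (I : set T1) (J : set T2)
    (a : T1 -> T2 -> \bar R) : (forall i j, I i -> J j -> 0 <= a i j) ->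
  \esum_(i in I) \esum_(j in J) a i j = \esum_(j in J) \esum_(i in I) a i j.
Proof.
move=> a0; rewrite esum_esum// esum_esum; last by move=> j i Jj Ii; exact: a0.
rewrite (@reindex_esum _ _ _ (J `*`` fun=> I) _ (fun k => (k.2, k.1)))//.
split.
- by move=> [j i] [].
- by move=> [j i] [j' i'] _ _ [-> ->].
- by move=> [i j] [Ii Jj]; exists (j, i).
Qed.

Lemma esum_seqID (T : choiceType) (F : seq T) (a : T -> R) :
    uniq F -> (forall i, (0 <= a i)%R) ->
  \esum_(i in [set: T]) (a i)%:E =
  (\sum_(i <- F) a i)%R%:E + \esum_(i in ~` [set` F]) (a i)%:E.
Proof.
move=> uF a0; rewrite (esumID [set` F])// ?setTI; last by move=> *; rewrite lee_fin.
congr (_ + _); rewrite esum_fset//; last by move=> *; rewrite lee_fin.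
by rewrite -fsbig_seq// sumEFin.
Qed.

(** Outside [F] the sum of [w * g] is at most the sum of [w], that is, the mass missing from [F]. *)
Lemma esum_finite_approx (T : choiceType) (F : seq T) (w g : T -> R) (G : R) :
    uniq F -> (forall i, (0 <= w i)%R) -> (forall i, (0 <= g i <= 1)%R) ->
    \esum_(i in [set: T]) (w i)%:E = 1 ->
    \esum_(i in [set: T]) (w i * g i)%:E = G%:E ->
  (0 <= G - \sum_(i <- F) w i * g i <= 1 - \sum_(i <- F) w i)%R.
Proof.
move=> uF w0 g01; have wg0 i : (0 <= w i * g i)%R.
  by rewrite mulr_ge0//; case/andP: (g01 i).
rewrite (esum_seqID uF w0) (esum_seqID uF wg0) => w1 wgG.
have le_rest : \esum_(i in ~` [set` F]) (w i * g i)%:E <= \esum_(i in ~` [set` F]) (w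
    i)%:E.
  apply: le_esum => i _; rewrite lee_fin ler_piMr//.
  by case/andP: (g01 i).
have rest_ge0 : 0 <= \esum_(i in ~` [set` F]) (w i * g i)%:E.
  by apply: esum_ge0 => i _; rewrite lee_fin.
move: w1 wgG le_rest rest_ge0.
case: (\esum_(i in ~` [set` F]) (w i)%:E) => [x| |] //; last first.
case: (\esum_(i in ~` [set` F]) (w i * g i)%:E) => [y| |] //.
rewrite -!EFinD => -[wE] [wgE]; rewrite !lee_fin => yx y0.
by apply/andP; split; lra.
Qed.

End EsumFacts.

(** * Small-time expansion of the probability to be in [E] *)

Section SmallTime.
Context {R : realType} {S : choiceType}.
Variables (n : nat) (a : 'I_n -> S -> S) (p : R -> S -> S -> R) (E : set S).

Definition jump_rate (s s' : S) : R :=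
  \sum_(i < n) ((a i s == s')%:R - (s == s')%:R).

Hypothesis p_trans : transition_function p.
Hypothesis p_rates : has_rates p jump_rate.

Definition generator (f : S -> R) (s : S) : R := \sum_(i < n) (f (a i s) - f s).

Definition hit_prob (t : R) (s : S) : R := fine (\esum_(s' in E) (p t s s')%:E)%E.

Let p_ge0 t s s' : 0 <= t -> 0 <= p t s s'.
Proof. by have [+ _ _ _] := p_trans; exact. Qed.

Let esum_le1 t s : 0 <= t -> (\esum_(s' in E) (p t s s')%:E <= 1)%E.
Proof.
move=> t0; have [_ p1 _ _] := p_trans; rewrite -(p1 t s t0) esum_mkcond.
apply: le_esum => s' _; case: ifP => // _.
by rewrite lee_fin p_ge0.
Qed.

Let esum_hit_ge0 t s : 0 <= t -> (0 <= \esum_(s' in E) (p t s s')%:E)%E.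
Proof. by move=> t0; apply: esum_ge0 => s' _; rewrite lee_fin p_ge0. Qed.

Lemma hit_probE t s : 0 <= t ->
  (\esum_(s' in E) (p t s s')%:E)%E = (hit_prob t s)%:E.
Proof.
move=> t0; rewrite fineK// ge0_fin_numE ?esum_hit_ge0//.
exact: le_lt_trans (esum_le1 _ t0) (ltry 1).
Qed.

Lemma hit_prob01 t s : 0 <= t -> 0 <= hit_prob t s <= 1.
Proof. by move=> t0; rewrite -!lee_fin -hit_probE// esum_hit_ge0// esum_le1. Qed.

Lemma hit_prob0 s : hit_prob 0 s = (s \in E)%:R.
Proof.
have [_ _ p0 _] := p_trans; rewrite /hit_prob esum_mkcond.
rewrite (esumID [set s])//; last first.
  by move=> s' _; case: ifP => // _; rewrite p0 lee_fin ler0n.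
rewrite setTI esum_set1; last by case: ifP => // _; rewrite p0 lee_fin ler0n.
rewrite esum1 ?adde0 ?p0 ?eqxx; first by case: ifP.
by move=> s' [_ /eqP ss']; rewrite p0 eq_sym (negPf ss'); case: ifP.
Qed.

(** The Chapman-Kolmogorov equation summed over [E], with the two sums of nonnegative terms
    exchanged. *)
Lemma hit_prob_first_step d t s : 0 <= d -> 0 <= t ->
  (\esum_(z in [set: S]) (p d s z * hit_prob t z)%:E = (hit_prob (d + t) s)%:E)%E.
Proof.
move=> d0 t0; rewrite -hit_probE ?addr_ge0//; have [_ _ _ chapman] := p_trans.
under [RHS]eq_esum do rewrite chapman//.
rewrite esum_exchange; last by move=> *; rewrite lee_fin mulr_ge0// p_ge0.
apply: eq_esum => z _; rewrite EFinM -hit_probE// -esumZl ?p_ge0//.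
by move=> s'; rewrite lee_fin p_ge0.
Qed.

Lemma jump_rate_support (F : seq S) (f : S -> R) s : uniq F -> s \in F ->
    (forall i, a i s \in F) ->
  \sum_(z <- F) jump_rate s z * f z = generator f s.
Proof.
move=> uF sF aF.
have pick x : x \in F -> \sum_(z <- F) (x == z)%:R * f z = f x.
  move=> xF; rewrite (bigD1_seq x)//= eqxx mul1r big1 ?addr0// => z zx.
  by rewrite eq_sym (negPf zx) mul0r.
rewrite /jump_rate /generator; under eq_bigr do rewrite mulr_suml.
rewrite exchange_big/=; apply: eq_bigr => i _.
under eq_bigr do rewrite mulrBl.
by rewrite sumrB !pick.
Qed.

(* Uniformity in [t] is what makes the left derivative accessible. *)
Lemma hit_prob_increment (e : R) s : 0 < e ->
  \forall d \near 0^'+, forall t, 0 <= t ->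
    `|hit_prob (d + t) s - hit_prob t s - d * generator (hit_prob t) s| <= e * d.
Proof.
(* All rates out of [s] are supported on this finite set; the remaining states are handled through
   total mass. *)
move=> e0; pose F := undup (s :: [seq a i s | i <- enum 'I_n]).
have uF : uniq F by exact: undup_uniq.
have sF : s \in F by rewrite mem_undup mem_head.
have aF i : a i s \in F.
  by rewrite mem_undup inE map_f ?orbT// mem_enum.
pose rest d z := p d s z - (s == z)%:R - d * jump_rate s z.
(* The factor 2 shares the error between the states of [F] and the tail outside [F]. *)
pose m : R := (2 * (size F).+1)%N%:R.
have m0 : 0 < m by rewrite ltr0n.
have near_rest (G : seq S) : \forall d \near 0^'+, \sum_(z <- G) `|rest d z| <= e / m
    * d *+ size G.
  elim: G => [|z G IHG]; first by apply: nearW => d; rewrite big_nil.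
  have /cvgrPdist_le/(_ (e / m) (divr_gt0 e0 m0)) zr := @p_rates s z.
  near=> d; rewrite big_cons mulrS lerD//; last by near: d.
  have d0 : 0 < d by near: d; exact: nbhs_right_gt.
  have : `|jump_rate s z - (p d s z - (s == z)%:R) / d| <= e / m by near: d.
  have -> : rest d z = ((p d s z - (s == z)%:R) / d - jump_rate s z) * d.
    by rewrite mulrBl divfK ?gt_eqF// [jump_rate s z * d]mulrC.
  by rewrite normrM (gtr0_norm d0) ler_pM2r// distrC.
near=> d => t t0.
have d0 : 0 < d by near: d; exact: nbhs_right_gt.
have d0' := ltW d0.
have restF : \sum_(z <- F) `|rest d z| <= e / m * d *+ size F by near: d.
have restg (g : S -> R) : (forall z, 0 <= g z <= 1) ->
    `|\sum_(z <- F) p d s z * g z - g s - d * generator g s| <= e / m * d *+ size F.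
  move=> g01; apply: le_trans restF.
  have -> : \sum_(z <- F) p d s z * g z - g s - d * generator g s = \sum_(z <- F)
      rest d z * g z.
    rewrite -(jump_rate_support g uF sF aF) mulr_sumr.
    have <- : \sum_(z <- F) (s == z)%:R * g z = g s.
      rewrite (bigD1_seq s)//= eqxx mul1r big1 ?addr0// => z zs.
      by rewrite eq_sym (negPf zs) mul0r.
    by rewrite -!sumrB; apply: eq_bigr => z _; rewrite /rest !mulrBl mulrA.
  apply: (le_trans (ler_norm_sum _ _ _)); apply: ler_sum => z _.
  by rewrite normrM ler_piMr// ger0_norm; case/andP: (g01 z).
have u01 z := hit_prob01 z t0.
have [_ p1 _ _] := p_trans.
have /andP[tail0 tail1] := esum_finite_approx uF (fun z => p_ge0 s z d0') u01 (p1 d s d0')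
  (hit_prob_first_step s d0' t0).
(* For the constant 1 the generator vanishes, so the same expansion bounds the mass outside [F]. *)
have := restg (fun=> 1) (fun=> _); rewrite ler01 lexx => /(_ (fun=> isT)).
have gen1 : generator (fun=> 1) s = 0 by rewrite /generator big1// => i _; rewrite subrr.
under eq_bigr do rewrite mulr1.
rewrite gen1 mulr0 subr0 distrC => /(le_trans (ler_norm _)) tail2.
have A0 := le_trans (normr_ge0 _) (restg _ u01).
have := restg _ u01.
have -> : e * d = (e / m * d *+ (size F).+1) *+ 2.
  by rewrite -mulrnA -mulr_natr mulnC -/m mulrAC divfK ?gt_eqF.
have mono : e / m * d *+ size F <= e / m * d *+ (size F).+1.
  by rewrite mulrS lerDr mulr_ge0// divr_ge0// ltW.
rewrite mulr2n; set x := hit_prob (d + t) s in tail0 tail1 *.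
move: A0 mono tail2; move: (e / m * d *+ size F) (e / m * d *+ (size F).+1).
by move=> A A' A0 AA' tail2; rewrite !ler_norml => /andP[b1 b2]; lra.
Unshelve. all: by end_near.
Qed.

End SmallTime.


(** * Regularity in time and the backward equation *)

Section HitProbRegularity.
Context {R : realType}.

Lemma near_right_exists (Q : R -> Prop) : (\forall d \near 0^'+, Q d) ->
  exists2 eta : R, 0 < eta & forall d : R, 0 < d < eta -> Q d.
Proof.
move=> [eta /= eta0 Qeta]; exists eta => // d /andP[d0 deta].
by apply: Qeta => //=; rewrite sub0r normrN gtr0_norm.
Qed.

Lemma is_derive_eps (f : R -> R) (t l : R) :
    (forall e : R, 0 < e -> exists2 eta : R, 0 < eta &
      forall h : R, 0 < `|h| < eta -> `|f (h + t) - f t - h * l| <= e * `|h|) ->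
  is_derive t (1 : R) f l.
Proof.
move=> fl; suff cv : h^-1 *: ((f \o shift t) (h *: (1 : R)) - f t) @[h --> 0^'] --> l.
  by apply: DeriveDef; [apply/cvg_ex; exists l|exact/cvg_lim].
apply/cvgrPdist_le => e e0; have [eta eta0 feta] := fl e e0.
exists eta => //= h; rewrite /ball_ /= sub0r normrN => h_eta h0.
rewrite -normr_gt0 in h0.
have := feta h; rewrite h0 h_eta => /(_ isT) fh.
rewrite -(ler_pM2r h0) -normrM mulrBl [_ * h]mulrC; apply: le_trans fh.
have hN0 : h != 0 by rewrite -normr_gt0.
rewrite -[_ *: _]/(h^-1 * (f (h * 1 + t) - f t)) mulr1 mulrAC mulVf// mul1r.
by rewrite distrC.
Qed.

Context {S : choiceType}.
Variables (n : nat) (a : 'I_n -> S -> S) (p : R -> S -> S -> R) (E : set S).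
Hypothesis p_trans : transition_function p.
Hypothesis p_rates : has_rates p (jump_rate a).
Local Notation u := (hit_prob p E).

(** Values of [u] lie in [[0, 1]], so the generator is at most [n] in absolute value; the extra 1 is
    the expansion error for [e = 1]. *)
Lemma hit_prob_lipschitz s : \forall d \near 0^'+, forall t, 0 <= t ->
  `|u (d + t) s - u t s| <= (n%:R + 1) * d.
Proof.
have inc := hit_prob_increment E p_trans p_rates s ltr01.
near=> d => t t0; have d0 : 0 < d by near: d; exact: nbhs_right_gt.
have /(_ t t0) : forall t, 0 <= t -> `|u (d + t) s - u t s - d * generator a (u t) s|
    <= 1 * d.
  by near: d.
have : `|d * generator a (u t) s| <= n%:R * d.
  rewrite normrM (gtr0_norm d0) mulrC ler_pM2r//.
  apply: (le_trans (ler_norm_sum _ _ _)).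
  rewrite -[X in _ <= X%:R](card_ord n) -sumr_const; apply: ler_sum => i _.
  have /andP[x0 x1] := hit_prob01 E p_trans (a i s) t0.
  have /andP[y0 y1] := hit_prob01 E p_trans s t0.
  by rewrite ler_norml; apply/andP; split; lra.
rewrite !ler_norml => /andP[x1 x2] /andP[y1 y2]; apply/andP; split; lra.
Unshelve. all: by end_near.
Qed.

Lemma hit_prob_continuous s (T : R) : {within `[0, T], continuous (u ^~ s)}.
Proof.
have [eta eta0 lip] := near_right_exists (hit_prob_lipschitz s).
have n1 : 0 < n%:R + 1 :> R by rewrite ltr_wpDl.
apply/subspace_continuousP => x /=; rewrite in_itv/= => /andP[x0 xT].
apply/cvgrPdist_le => e e0; near=> y.
have y0 : 0 <= y.
  have : `[0, T]%classic y by near: y; exact: withinT.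
  by rewrite /= in_itv/= => /andP[].
have xy1 : `|x - y| < eta.
  by near: y; apply: cvg_within; exact: (nbhsx_ballx x eta eta0).
have xy2 : (n%:R + 1) * `|x - y| <= e.
  rewrite mulrC -ler_pdivlMr// ltW//; near: y; apply: cvg_within.
  exact: (nbhsx_ballx x _ (divr_gt0 e0 n1)).
apply: le_trans xy2; case: (ltgtP x y) xy1 => [xy|xy|->] xy1.
- have d0 : 0 < y - x by rewrite subr_gt0.
  rewrite (distrC x) (gtr0_norm d0) in xy1 *.
  by have := lip (y - x); rewrite d0 xy1 => /(_ isT x x0); rewrite subrK distrC.
- have d0 : 0 < x - y by rewrite subr_gt0.
  rewrite (gtr0_norm d0) in xy1 *.
  by have := lip (x - y); rewrite d0 xy1 => /(_ isT y y0); rewrite subrK.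
- by rewrite !subrr normr0 mulr0.
Unshelve. all: by end_near.
Qed.

(** On the right this is the expansion at [t]. On the left the expansion starts at [t - d], which is
    possible by its uniformity in time, and the Lipschitz bound moves the generator from [t - d] to
    [t]. *)
Lemma is_derive_hit_prob s (t : R) : 0 < t ->
  is_derive t (1 : R) (u ^~ s) (generator a (u t) s).
Proof.
move=> t0; apply: is_derive_eps => e e0; have e20 : 0 < e / 2 by rewrite divr_gt0.
have [eta1 eta1_gt0 inc] := near_right_exists (hit_prob_increment E p_trans p_rates s
    e20).
(* Here [None] stands for [s] itself, so that one threshold serves [s] and all its successors. *)
have lip_near : \forall d \near 0^'+, forall z : option 'I_n, forall t, 0 <= t ->
    `|u (d + t) (if z is Some i then a i s else s) -
      u t (if z is Some i then a i s else s)| <= (n%:R + 1) * d.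
  by apply: filter_forall => z; exact: hit_prob_lipschitz.
have [eta2 eta2_gt0 lip] := near_right_exists lip_near.
pose M : R := n%:R * ((n%:R + 1) + (n%:R + 1)) + 1.
have M0 : 0 < M by rewrite ltr_wpDl// mulr_ge0// !addr_ge0.
exists (Num.min (Num.min eta1 eta2) (Num.min t (e / 2 / M))).
  by rewrite !lt_min eta1_gt0 eta2_gt0 t0 divr_gt0.
move=> h /andP[h0]; rewrite !lt_min => /andP[/andP[h1 h2] /andP[h3 h4]].
have [hpos|hneg|hz] := ltgtP h 0; last first.
- by rewrite hz normr0 ltxx in h0.
- rewrite gtr0_norm// in h0 h1 *; have := inc h; rewrite h0 h1 => /(_ isT t (ltW t0))
    /le_trans; apply.
  by rewrite ler_pM2r// ler_pdivrMr// ler_pMr// ler1n.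
pose d := - h; have hE : h = - d by rewrite opprK.
have d0 : 0 < d by rewrite oppr_gt0.
rewrite hE normrN (gtr0_norm d0) in h1 h2 h3 h4 *.
have td0 : 0 <= t - d by rewrite subr_ge0 ltW.
have := inc d; rewrite d0 h1 => /(_ isT _ td0); rewrite [d + _]addrC subrK => incd.
have genB : `|generator a (u (t - d)) s - generator a (u t) s| <= M * d.
  rewrite /generator -sumrB; apply: (le_trans (ler_norm_sum _ _ _)).
  apply: (@le_trans _ _ (\sum_(i < n) ((n%:R + 1) + (n%:R + 1)) * d)); last first.
    by rewrite sumr_const card_ord -mulrnAl -[_ *+ n]mulr_natl ler_pM2r// lerDl.
  apply: ler_sum => i _; have := lip d; rewrite d0 h2 => /(_ isT) lipd.
  have := lipd (Some i) _ td0; have := lipd None _ td0; rewrite [d + _]addrC subrK.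
  rewrite !ler_norml => /andP[x1 x2] /andP[y1 y2]; apply/andP; split; lra.
have genB2 : `|d * (generator a (u (t - d)) s - generator a (u t) s)| <= e / 2 * d.
  rewrite normrM (gtr0_norm d0) mulrC ler_pM2r// (le_trans genB)//.
  by rewrite mulrC -ler_pdivlMr// ltW.
move: incd genB2; rewrite [- d + t]addrC mulrBr !ler_norml.
by move=> /andP[x1 x2] /andP[y1 y2]; apply/andP; split; lra.
Qed.

End HitProbRegularity.

(** * Probabilities of events of the process *)

Section HitProbEvent.
Context {R : realType} {d} {W : measurableType d} (P : probability W R).
Context {S : countType}.
Variables (Z : R -> W -> S) (p : R -> S -> S -> R) (s0 : S).
Hypothesis Zp : markov_process P Z p s0.

(** The Markov property is used at time 0 with an empty past. Intersecting with the almost sure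
    event [Z 0 w = s0] does not change the probability. *)
Lemma markov_state_prob (t : R) s : 0 <= t ->
  P [set w | Z t w = s] = (p t s0 s)%:E.
Proof.
move=> t0; have [mZ Z0 mk] := Zp.
have := mk [::] 0 t s0 s (fun _ => _) (lexx _) t0; rewrite add0r => mk0.
have {}mk0 : P ([set w | Z 0 w = s0] `&` [set w | Z t w = s]) = (p t s0 s)%:E.
  rewrite -[RHS]mul1e -Z0 [X in P X](_ : _ = [set w | [/\ forall uz, uz \in [::] -> Z
      uz.1 w = uz.2,
                       Z 0 w = s0 & Z t w = s]]); last first.
    by apply/seteqP; split => w /= [].
  rewrite mk0//; congr (P _ * _)%E.
  by apply/seteqP; split => w /= => [[]|].
have m1 := mZ t s t0; have m0 := mZ 0 s0 (lexx _).
have := measureDI P m1 m0; rewrite setIC.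
rewrite [X in _ = (X + _)%E -> _](_ : _ = 0%E) => [->|]; first by rewrite add0e -mk0.
apply/eqP; rewrite -measure_le0.
apply: (@le_trans _ _ (P (~` [set w | Z 0 w = s0]))).
  apply: le_measure; rewrite ?inE; [exact: measurableD|exact: measurableC|].
  exact: subIsetr.
by rewrite probability_setC// Z0 subee.
Qed.

(** Countable additivity, with the states numbered by [pickle]. *)
Lemma markov_event_prob (t : R) (E : set S) : 0 <= t ->
  P [set w | E (Z t w)] = (\esum_(s in E) (p t s0 s)%:E)%E.
Proof.
move=> t0; have [mZ _ _] := Zp.
have mF k : (pickle @` E) k -> measurable [set w | pickle (Z t w) = k].
  move=> [s _ <-]; rewrite (_ : [set w | _] = [set w | Z t w = s]); first exact: mZ.
  by apply/seteqP; split => w /= => [/(pcan_inj pickleK)|->].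
rewrite (_ : [set w | E (Z t w)] = \bigcup_(k in pickle @` E) [set w | pickle (Z t w)
    = k]); last first.
  apply/seteqP; split => [w Ew|w [k [s Es <-] /= /(pcan_inj pickleK) ->//]].
  by exists (pickle (Z t w)); first by exists (Z t w).
rewrite measure_bigcup//; last first.
  by move=> i j _ _ [w [/= <- <-]].
rewrite nneseries_esum//.
rewrite (@reindex_esum _ _ _ E _ pickle); last first.
  split.
  - by move=> s Es /=; rewrite inE; exists s.
  - by move=> x y _ _; exact: (pcan_inj pickleK).
  - by move=> k /=; rewrite inE => -[s Es <-]; exists s.
apply: eq_esum => s _; rewrite -markov_state_prob//; congr (P _).
by apply/seteqP; split => w /= => [/(pcan_inj pickleK)|->].
Qed.

End HitProbEvent.

(** * The TASEP with second class particles *)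

Section TasepStep.
Variable N : nat.
Implicit Types (s : state N) (i j : 'I_N).

Lemma pos_mono s : {homo pos s : i j / (i < j)%N >-> i < j}.
Proof.
move=> i j ij; have sP : increasing (pos s) := valP s.
by have := forallP (forallP sP i) j; rewrite ij.
Qed.

(** Positions are strictly increasing integers, so no particle fits between adjacent sites. *)
Lemma pos_succ s i j : pos s j = pos s i + 1 -> j = i.+1 :> nat.
Proof.
move=> pji; have [ij|ji|/val_inj ij] := ltngtP i j; last 2 first.
- have := pos_mono s ji; rewrite pji; lia.
- move: pji; rewrite ij; lia.
have iN : (i.+1 < N)%N by apply: leq_ltn_trans (ltn_ord j).
have i_lt : pos s i < pos s (Ordinal iN) by exact: pos_mono.
have [jE|ltij|//] := ltngtP j i.+1; first by move: jE; rewrite ltnS leqNgt ij.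
have := @pos_mono s (Ordinal iN) j ltij; move: i_lt; rewrite pji; lia.
Qed.

Lemma pos_attempt s i :
  pos (attempt i s) = pos s \/ pos (attempt i s) = step_right (pos s) i.
Proof.
rewrite /pos /attempt /= /attempt_config; case: pickP => [j _|_]; last by right.
by left; case: ifP.
Qed.

Lemma attempt_free s i : (forall j, pos s j != pos s i + 1) ->
  pos (attempt i s) = step_right (pos s) i /\ word (attempt i s) = word s.
Proof.
move=> free; rewrite /pos /word /attempt /= /attempt_config.
by case: pickP => [j|//]; rewrite (negPf (free j)).
Qed.

Lemma attempt_blocked s i j : pos s j = pos s i + 1 ->
  attempt i s = if (word s i == first_class) && (word s j == second_class)
    then attempt i s else s.
Proof.
move=> pji; case: ifP => // swapF; apply: val_inj.
rewrite /= /attempt_config; case: pickP => [k /eqP pki|/(_ j)]; last by rewrite pji eqxx.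
have -> : k = j.
  by apply: val_inj; rewrite /= (pos_succ pki) (pos_succ pji).
by rewrite swapF /pos /word; case: (config s).
Qed.

Lemma attempt_swap s i j : pos s j = pos s i + 1 ->
    word s i == first_class -> word s j == second_class ->
  word (attempt i s) j = first_class.
Proof.
move=> pji wi wj; rewrite /word /attempt /= /attempt_config.
case: pickP => [k /eqP pki|/(_ j)]; last by rewrite pji eqxx.
have -> : k = j.
  by apply: val_inj; rewrite /= (pos_succ pki) (pos_succ pji).
by rewrite wi wj /= ffunE tpermR (eqP wi).
Qed.

Lemma word21_first i : (word21 N i == first_class) = (i == 0%N :> nat).
Proof. by rewrite ffunE; case: ifP. Qed.

Lemma word21_second i : (word21 N i == second_class) = (i != 0%N :> nat).
Proof. by rewrite ffunE; case: ifP. Qed.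

Lemma word_attempt_swap_neq s i j : pos s j = pos s i + 1 ->
    word s i == first_class -> word s j == second_class ->
  word (attempt i s) != word21 N.
Proof.
move=> pji wi wj; apply/eqP => wE; have := attempt_swap pji wi wj.
by rewrite wE => /eqP; rewrite word21_first (pos_succ pji).
Qed.

(** The word 21...1 cannot be entered from another word: a swap leaves a first class letter at a
    positive index, and any other attempt keeps the word. This justifies extending the determinant
    by 0. *)
Lemma word_attempt_neq21 s i :
  word s != word21 N -> word (attempt i s) != word21 N.
Proof.
move=> ws; have [/existsP[j /eqP pji]|] := boolP [exists j, pos s j == pos s i + 1].
  have := attempt_blocked pji; case: ifP => [/andP[wi wj] _|_ ->//].
  exact: word_attempt_swap_neq pji wi wj.
by rewrite negb_exists => /forallP free; case: (attempt_free free) => _ ->.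
Qed.

End TasepStep.

(** * The determinant as a function on states *)

Section BetheSolution.
Context {R : realType}.
Variables (N : nat) (F : nat -> int -> R) (x : int).
Hypothesis Frec : forall p m, F p.+1 m - F p.+1 (m - 1) = F p m.

Definition bethe (s : state N) : R :=
  if word s == word21 N then \det (bethe_mx F (fun k => pos s k - x)) else 0.

(* The boundary conditions of the determinant encode the exclusion rule between
   second class particles and the absorption once the first class particle has
   overtaken. *)
Lemma bethe_attempt s i : word s = word21 N ->
  bethe (attempt i s) =
  \det (bethe_mx F (fun k => pos s k - x + (k == i)%:R)).
Proof.
move=> ws; have [/existsP[j /eqP pji]|] := boolP [exists j, pos s j == pos s i + 1].
  have ji := pos_succ pji; have := attempt_blocked pji; case: ifP => [/andP[wi wj] _|].
    (* Overtaking forces [i = 0]: the left side is 0 by definition, the right side because rows 0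
       and 1 coincide. *)
    rewrite /bethe (negPf (word_attempt_swap_neq pji wi wj)).
    rewrite (@det_bethe_mx_kill _ _ _ _ i j)//.
    - by move: wi; rewrite ws word21_first => /eqP.
    - by rewrite ji; move: wi; rewrite ws word21_first => /eqP ->.
    - by rewrite eqxx -val_eqE /= ji gtn_eqF// pji addr0 addrAC.
  (* The attempt is forbidden, and [i] is positive because the particle ahead is always second
     class. *)
  rewrite ws word21_first word21_second ji andbT => i0 ->.
  rewrite /bethe ws eqxx (@det_bethe_mx_block _ _ _ _ i j Frec)//.
  - by rewrite lt0n i0.
  - by rewrite pji addrAC.
rewrite negb_exists => /forallP free; have [pE wE] := attempt_free free.
rewrite /bethe wE ws eqxx; congr (\det _); apply/matrixP => k a; rewrite !mxE.
by congr (F _ (_ - _)); rewrite pE ffunE; case: eqP => _; rewrite ?addr0// addrAC.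
Qed.

End BetheSolution.

(** * Comparison with the stated contour integrals *)

Section ContourMatrix.
Context {R : realType}.
Variable r : R.
Hypotheses (hr0 : 0 < r) (hr1 : r < 1).

Lemma circle_factorE (z e : R[i]) (p : nat) (m : int) : z != 0 ->
  z ^ (- 1 - m) * (z - 1) ^ (- p%:Z) * e * ('i%C * z) =
  ((-1) ^+ p)%:C * ('i%C * (z ^ (- m) * (1 - z) ^- p * e)).
Proof.
move=> z0; have -> : (z - 1) ^ (- p%:Z) = (-1) ^+ p * (1 - z) ^- p.
  rewrite -exprnN -(opprB 1 z) [(- (1 - z)) ^+ p]exprNn invfM.
  by rewrite -[((-1) ^+ p)^-1]exprVn invrN1.
rewrite expfzDr// exprN1 rmorphXn rmorphN1.
set c := (-1) ^+ p; set zm := z ^ _; set y := _ ^- p.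
rewrite [LHS](_ : _ = z^-1 * z * (c * ('i%C * (zm * y * e)))); last by ring.
by rewrite mulVf// mul1r.
Qed.

(** The factor [i] of [dxi] exchanges real and imaginary parts: [I1] vanishes by [contour_im], and
    [I2] carries the real contour integral. The sign comes from [xi - 1] in place of [1 - xi]. *)
Lemma circle_integral_contour (p : nat) (m : int) (t : R) : 0 <= t ->
  (2 * pi%:C * 'i%C)^-1 * circle_integral r (fun xi : R[i] =>
     xi ^ (- 1 - m) * (xi - 1) ^ (- p%:Z) * cexp ((xi^-1 - 1) * t%:C)) =
  ((-1) ^+ p * contour r 1 p m t)%:C.
Proof.
move=> t0; have pi2_gt0 : 0 < 2 * pi :> R by rewrite mulr_gt0// pi_gt0.
have gE u : let z := circ r u in
    z ^ (- 1 - m) * (z - 1) ^ (- p%:Z) * cexp ((z^-1 - 1) * t%:C) * ('i%C * z) =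
    (- ((-1) ^+ p * contour_integrand r (- 'i) p m t u)) +i*
    ((-1) ^+ p * contour_integrand r 1 p m t u).
  rewrite /= circle_factorE ?circ_neq0// /contour_integrand mul1r -!mulrA.
  rewrite !(mulrA (circ r u ^ (- m))); case: (_ * cexp _) => a b /=.
  by apply/eqP; rewrite eq_complex /=; apply/andP; split; apply/eqP; ring.
rewrite /circle_integral /cintegral.
set I1 := Rintegral _ _ _; set I2 := Rintegral _ _ _.
have -> : I1 = 0.
  rewrite /I1 (_ : (fun u => _) = fun u => - (-1) ^+ p * contour_integrand r (- 'i) p
      m t u); last first.
    by apply/funext => u; rewrite gE mulNr.
  rewrite RintegralZl//; last exact: contour_integrand_integrable.
  have := contour_im hr0 hr1 p m t0; rewrite /contour => /eqP.
  by rewrite mulf_eq0 invr_eq0 gt_eqF//= => /eqP ->; rewrite mulr0.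
have -> : I2 = (2 * pi) * ((-1) ^+ p * contour r 1 p m t).
  rewrite /I2 (_ : (fun u => _) = fun u => (-1) ^+ p * contour_integrand r 1 p m t
      u); last first.
    by apply/funext => u; rewrite gE.
  rewrite RintegralZl//; last exact: contour_integrand_integrable.
  by rewrite /contour mulrCA mulVKf// gt_eqF.
set y := _ * contour _ _ _ _ _.
have -> : 0 +i* (2 * pi * y) = (2 * pi%:C * 'i%C) * y%:C :> R[i].
  by apply/eqP; rewrite eq_complex /=; apply/andP; split; apply/eqP; ring.
rewrite mulKf// mulf_neq0//; last by rewrite eq_complex /= oner_eq0 andbF.
by rewrite mulf_neq0// eq_complex /= ?eqxx ?andbT gt_eqF// pi_gt0.
Qed.

Lemma det_circle_integral N (x : int) (t : R) : (0 < N)%N -> 0 <= t ->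
  \det (\matrix_(i < N, j < N)
    ((2 * pi%:C * 'i%C)^-1 *
     circle_integral r (fun xi : R[i] =>
       xi ^ (i%:Z + j%:Z + x - N%:Z - 1) * (xi - 1) ^ (- (N%:Z - 1)) *
       cexp ((xi^-1 - 1) * t%:C)))) =
  ((-1) ^+ 'C(N, 2) *
   \det (bethe_mx (fun p m => contour r 1 p m t) (fun k : 'I_N => k.+1%:Z - x)))%:C.
Proof.
move=> N0 t0; rewrite -(@det_bethe_mx_step _ (fun p m => contour r 1 p m t) N x);
    last first.
  by move=> p m; exact: contour_rec.
rewrite -(det_map_mx (real_complex R)).
have -> : (\matrix_(i < N, j < N)
    ((2 * pi%:C * 'i%C)^-1 *
     circle_integral r (fun xi : R[i] =>
       xi ^ (i%:Z + j%:Z + x - N%:Z - 1) * (xi - 1) ^ (- (N%:Z - 1)) *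
       cexp ((xi^-1 - 1) * t%:C)))) = ((-1) ^+ N.-1) *:
   map_mx (real_complex R) (\matrix_(i < N, j < N) contour r 1 N.-1 (N%:Z - x - i%:Z
       - j%:Z) t).
  apply/matrixP => i j; rewrite !mxE.
  have -> : i%:Z + j%:Z + x - N%:Z - 1 = - 1 - (N%:Z - x - i%:Z - j%:Z) by lia.
  have -> : N%:Z - 1 = N.-1%:Z by lia.
  by rewrite circle_integral_contour// rmorphM rmorphXn rmorphN1.
(* The entrywise sign contributes [(-1)^((N-1)N)], which is 1 because the exponent is even. *)
rewrite detZ -exprM -signr_odd oddM.
by case: N N0 => // n _ /=; rewrite andbN expr0 mul1r.
Qed.

End ContourMatrix.

(** * Identification of the two solutions *)

Section HitProbBethe.
Context {R : realType}.
Variables (N : nat) (hN : (0 < N)%N) (x : int).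
Variable r : R.
Hypotheses (hr0 : 0 < r) (hr1 : r < 1).
Local Notation F t := (fun p m => contour r 1 p m t).

Lemma bethe_contour_initial (s : state N) :
  bethe (F 0) x s = (s \in E_event hN x)%:R.
Proof.
have -> : (s \in E_event hN x) = (word s == word21 N) && (pos s (Ordinal hN) == x).
  by apply/idP/andP => [/set_mem[-> ->]|[/eqP ws /eqP ps]]; rewrite ?eqxx// inE.
rewrite /bethe; case: eqP => //= _.
case: N hN s => // n hn s.
rewrite det_bethe_mx_initial.
- by rewrite subr_eq0; congr (pos s _ == x)%:R; exact: val_inj.
- by move=> m; rewrite contour_initial0// [complex.Re _]/= mul1r.
- by move=> p m; exact: contour_initial_neg.
- by move=> p m; exact: contour_rec.
- by move=> i j ij; rewrite ltrD2r; exact: pos_mono.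
Qed.

(** The forward difference in row [k] is the change of [bethe] under an attempt of particle [k]. Off
    the word 21...1 both sides are 0. *)
Lemma is_derive_bethe_contour (s : state N) (t : R) :
  is_derive t (1 : R) (fun t => bethe (F t) x s)
    (generator (@attempt N) (bethe (F t) x) s).
Proof.
have Frec p m : F t p.+1 m - F t p.+1 (m - 1) = F t p m by exact: contour_rec.
have [ws|ws] := eqVneq (word s) (word21 N); last first.
  rewrite (_ : (fun _ => _) = cst 0); last first.
    by apply/funext => y; rewrite /bethe (negPf ws).
  rewrite (_ : generator _ _ _ = 0); first exact: is_derive_cst.
  rewrite /generator big1// => i _.
  by rewrite /bethe (negPf ws) (negPf (word_attempt_neq21 i ws)) subrr.
rewrite (_ : (fun _ => _) = fun y => \det (bethe_mx (F y) (fun k => pos s k - x)));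
    last first.
  by apply/funext => y; rewrite /bethe ws eqxx.
apply: is_derive_eq.
  apply: (@is_derive_det _ _ _ (\matrix_(i, a)
    (F t (N.-1 - i.-1)%N (pos s i - x - a%:Z + 1) -
     F t (N.-1 - i.-1)%N (pos s i - x - a%:Z)))) => i a.
  rewrite mxE (_ : (fun _ => _) = contour r 1 (N.-1 - i.-1) (pos s i - x - a%:Z)).
    exact: is_derive_contour.
  by apply/funext => y; rewrite mxE.
rewrite /generator; apply: eq_bigr => k _.
rewrite (bethe_attempt x Frec k ws) /bethe ws eqxx -det_bethe_mx_shift.
congr (\det _); apply/matrixP => i a; rewrite !mxE.
by case: (i == k).
Qed.

(** The base [r^-1] matches the growth in [m] of the bound on [contour]; one jump changes the
    exponent by at most 1. *)
Definition state_weight (s : state N) : R :=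
  r^-1 ^+ (\sum_k `|(pos s k - x)%R|)%N.

Lemma state_weight_attempt (i : 'I_N) (s : state N) :
  state_weight (attempt i s) <= r^-1 * state_weight s.
Proof.
rewrite /state_weight -exprS ler_weXn2l ?invf_ge1 1?ltW//.
have [->|->] := pos_attempt s i; first exact: leqnSn.
apply: (@leq_trans (\sum_k (`|(pos s k - x)%R| + (k == i)))%N).
  by apply: leq_sum => k _; rewrite ffunE; case: (k == i); lia.
rewrite big_split/= addnC -addn1 addnC leq_add2l.
by rewrite (bigD1 i)//= eqxx big1 // => k /negPf ->.
Qed.

Lemma bethe_contour_bound (T : R) : 0 <= T -> exists2 K : R, 0 <= K &
  forall s t, 0 <= t <= T -> `|bethe (F t) x s| <= K * state_weight s.
Proof.
move=> T0; have r1 : 1 <= r^-1 by rewrite invf_ge1// ltW.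
have ri0 : 0 <= r^-1 by rewrite invr_ge0 ltW.
(* The first factor dominates every order up to [N.-1], the last one absorbs the column shift
   [a < N]. *)
pose K0 : R := (1 - r) ^- N * expR ((r^-1 + 1) * T) * r^-1 ^+ N.
have K00 : 0 <= K0.
  rewrite !mulr_ge0 ?expR_ge0 ?exprn_ge0// invr_ge0 exprn_ge0// subr_ge0.
  exact: ltW.
have K1 : 0 <= N`!%:R * K0 ^+ N by rewrite mulr_ge0// exprn_ge0.
exists (N`!%:R * K0 ^+ N) => // s t /andP[t0 tT].
have w0 : 0 <= state_weight s by rewrite exprn_ge0.
rewrite /bethe; case: eqP => _; last by rewrite normr0 mulr_ge0.
have := @normr_det_le R N (bethe_mx (F t) (fun k => pos s k - x))
  (fun k => K0 * r^-1 ^+ `|(pos s k - x)%R|%N).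
rewrite big_split/= prodr_const card_ord prodrXr mulrA; apply => i a.
rewrite mxE (le_trans (contour_boundP hr0 hr1 _ _ _ (_ : _ <= T)))//.
  by rewrite ger0_norm.
rewrite /contour_bound Normc.normc1 mul1r /K0 -!mulrA.
apply: ler_pM.
- by rewrite invr_ge0 exprn_ge0// subr_ge0 ltW.
- by rewrite mulr_ge0 ?expR_ge0// exprz_ge0// ltW.
- rewrite lef_pV2 ?posrE ?exprn_gt0 ?subr_gt0//.
  apply: ler_wiXn2l; first by rewrite subr_ge0 ltW.
    by rewrite gerBl ltW.
  exact: leq_trans (leq_subr _ _) (leq_pred N).
rewrite ler_wpM2l ?expR_ge0// (le_trans (contour_weight hr0 hr1 _))//.
rewrite -exprD ler_weXn2l//.
by have := ltn_ord a; clear; lia.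
Qed.

Lemma hit_prob_bethe (p : R -> state N -> state N -> R) (s : state N) (t : R) :
    transition_function p -> has_rates p (@tasep_rate R N) -> 0 <= t ->
  hit_prob p (E_event hN x) t s = bethe (F t) x s.
Proof.
move=> p_trans p_rates t0; apply/eqP; rewrite -subr_eq0; apply/eqP.
have [K K0 bethe_le] := bethe_contour_bound t0.
pose v (y : R) s := hit_prob p (E_event hN x) y s - bethe (F y) x s.
(* A probability is thus at most the weight, which explains the constant [1 + K] for the difference
   [v]. *)
have w1 z : 1 <= state_weight z by rewrite exprn_ege1// invf_ge1// ltW.
have K10 : 0 <= 1 + K by rewrite addr_ge0.
apply: (@weighted_uniqueness R (state N) N (@attempt N) state_weight r^-1 _
    state_weight_attempt v t (1 + K) K10).
- by rewrite invr_ge0 ltW.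
- move=> z; apply: (@within_continuousB _ _ _ _
    (hit_prob p (E_event hN x) ^~ z) (fun y => bethe (F y) x z)).
    exact: (@hit_prob_continuous _ _ _ (@attempt N) _ _ p_trans p_rates).
  by apply: is_derive_within_continuous => y; exact: is_derive_bethe_contour.
- move=> z y /andP[y0 _].
  have Du := is_derive_hit_prob (E_event hN x) p_trans p_rates z y0.
  apply: (is_derive_eq (is_deriveB Du (is_derive_bethe_contour z y))).
  rewrite /generator -sumrB; apply: eq_bigr => i _.
  by rewrite /v; ring.
- by move=> z; rewrite /v (hit_prob0 _ p_trans) bethe_contour_initial subrr.
- move=> z y yt; have /andP[y0 _] := yt; rewrite mulrDl mul1r.
  apply: (le_trans (ler_normB _ _)); apply: lerD; last exact: bethe_le.
  have /andP[u0 u1] := hit_prob01 (E_event hN x) p_trans z y0.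
  by rewrite ger0_norm// (le_trans u1).
- by rewrite t0 lexx.
Qed.

End HitProbBethe.

Theorem mainTheorem4 (R : realType) (d : measure_display)
    (W : measurableType d) (P : probability W R)
    (N : nat) (hN : (0 < N)%N)
    (Z : R -> W -> state N) (hZ : is_tasep P Z (step_state N))
    (x : int) (t : R) (ht : 0 <= t)
    (r : R) (hr0 : 0 < r) (hr1 : r < 1) :
  (fine (P [set w | E_event hN x (Z t w)]))%:C =
  (-1) ^+ ((N * (N - 1)) %/ 2)%N *
  \det (\matrix_(i < N, j < N)
    ((2 * pi%:C * 'i%C)^-1 *
     circle_integral r (fun xi : R[i] =>
       xi ^ (i%:Z + j%:Z + x - N%:Z - 1) * (xi - 1) ^ (- (N%:Z - 1)) *
       cexp ((xi^-1 - 1) * t%:C)))).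
Proof.
have [p [p_trans p_rates Zp]] := hZ.
rewrite det_circle_integral// subn1 divn2 -bin2 rmorphM rmorphXn rmorphN1.
(* The stated sign and the sign from reversing the rows are equal, so their product is 1. *)
rewrite mulrA -exprD addnn -signr_odd odd_double expr0 mul1r.
rewrite (markov_event_prob Zp)// -[fine _]/(hit_prob p (E_event hN x) t (step_state N)).
rewrite (hit_prob_bethe _ _ hr0 hr1)// /bethe eqxx; congr (\det _)%:C.
by apply/matrixP => k a; rewrite !mxE ffunE.
Qed.
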